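(* Let $S$ be a finite subset of Thompson's group $F$ such that the elements of $\pi(S)$ have a common co-generator in $\mathbb{Z}^2$. Then the elements of $S$ do not have a common co-generator in $F$ if and only if both of the following assertions hold. (1) The only common co-generators of the elements of $\pi(S)$ in $\mathbb{Z}^2$ are $(1,1)$ and $(-1,-1)$. (2) Every number $\beta\in(0,1)$ is fixed by some element of $S$.
   Context: Thompson's group $F$ is the group (under composition) of all orientation-preserving piecewise-linear homeomorphisms of $[0,1]$ with finitely many breakpoints, all breakpoints being dyadic fractions (elements of $\mathbb{Z}[\frac12]\cap(0,1)$) and all slopes being integer powers of $2$. The standard abelianization map $\pi\colon F\to\mathbb{Z}^2$ is $\pi(f)=(\log_2 f'(0^+),\log_2 f'(1^-))$. In a group $G$, an element $y$ is a co-generator of $x$ if $\langle x,y\rangle=G$; $y$ is a common co-generator of the elements of a set $X\subseteq G$ (in $G$) if $\langle x,y\rangle=G$ for every $x\in X$. *)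

(* Defs.v *)
From HB Require Import structures.
From mathcomp Require Import all_boot all_order all_algebra.
From mathcomp Require Import all_classical all_reals all_analysis.
From mathcomp Require Import ring lra.

Set Implicit Arguments.
Unset Strict Implicit.
Unset Printing Implicit Defensive.

Import Order.TTheory GRing.Theory Num.Theory.
Import numFieldNormedType.Exports.
Local Open Scope classical_set_scope.
Local Open Scope ring_scope.

Section Generation.
Local Open Scope group_scope.
Variable G : groupType.

Definition is_subgroup (H : set G) : Prop :=
  [/\ H 1, forall x y, H x -> H y -> H (x * y) & forall x, H x -> H x^-1].

Definition generated (A : set G) : set G := smallest is_subgroup A.

Definition cogenerator (x y : G) : Prop := generated [set x; y] = [set: G].

Definition common_cogenerator (X : set G) (y : G) : Prop :=
  forall x, X x -> cogenerator x y.

End Generation.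

(* The infinite cyclic group: int with addition as its (multiplicatively
   written) group law.  The group Z^2 is then the product Zgrp * Zgrp. *)
Definition Zgrp : Type := int.

HB.instance Definition _ := Choice.copy Zgrp int.
HB.instance Definition _ := isGroup.Build Zgrp
  (@addrA int) (@add0r int) (@addr0 int) (@addNr int) (@addrN int).

Section Thompson.
Variable R : realType.
Implicit Types f g : R -> R.

Definition dyadic (x : R) : Prop :=
  exists (m : int) (n : nat), x = m%:~R / 2 ^+ n.

(* Homeomorphisms of [0,1] preserving the orientation are represented by their
   extension by the identity to the whole line; this makes Leibniz equality of
   the representatives agree with equality of the homeomorphisms. *)
Definition oriented_homeo01 f : Prop :=
  [/\ forall x, x \notin `[0, 1] -> f x = x,
      {homo f : x y / x < y},
      continuous f
    & exists g, [/\ continuous g, cancel f g & cancel g f]].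

(* B contains the breakpoints of f, and f is affine, with a power of 2 as
   slope, on every subinterval of [0,1] without a point of B in its interior. *)
Definition dyadic_piecewise_linear f : Prop :=
  exists B : seq R,
    (forall c, c \in B -> 0 < c < 1 /\ dyadic c) /\
    (forall a b, 0 <= a -> a < b -> b <= 1 ->
       (forall c, c \in B -> ~~ (a < c < b)) ->
       exists k : int, forall x, a <= x <= b -> f x = f a + 2 ^ k * (x - a)).

Record thompsonF : Type := ThompsonF {
  thompson_fun :> R -> R;
  thompson_homeo : oriented_homeo01 thompson_fun;
  thompson_pl : dyadic_piecewise_linear thompson_fun
}.

Lemma thompsonF_eq (f g : thompsonF) : f =1 g -> f = g.
Proof.
case: f g => [f f1 f2] [g g1 g2] /= /funext fg; subst g.
by rewrite (Prop_irrelevance f1 g1) (Prop_irrelevance f2 g2).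
Qed.

Lemma dyadic0 : dyadic 0.
Proof. by exists 0, 0%N; rewrite mul0r. Qed.

Lemma dyadicD x y : dyadic x -> dyadic y -> dyadic (x + y).
Proof.
move=> [m [n ->]] [p [q ->]]; exists (m * 2 ^+ q + p * 2 ^+ n), (n + q)%N.
rewrite rmorphD /= !rmorphM /= !rmorphXn /= exprD.
have n0 : (2 : R) ^+ n != 0 by rewrite expf_neq0.
have q0 : (2 : R) ^+ q != 0 by rewrite expf_neq0.
by field; rewrite n0 q0.
Qed.

Lemma dyadicM x y : dyadic x -> dyadic y -> dyadic (x * y).
Proof.
move=> [m [n ->]] [p [q ->]]; exists (m * p), (n + q)%N.
by rewrite rmorphM /= exprD invfM mulrACA.
Qed.

Lemma dyadicN x : dyadic x -> dyadic (- x).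
Proof. by move=> [m [n ->]]; exists (- m), n; rewrite rmorphN /= mulNr. Qed.

Lemma dyadicXz (k : int) : dyadic (2 ^ k).
Proof.
case: k => n; first by exists (2 ^+ n), 0%N; rewrite rmorphXn /= divr1.
by exists 1, n.+1; rewrite NegzE mul1r.
Qed.

Lemma homeo01_mono f : oriented_homeo01 f -> {mono f : x y / x < y}.
Proof. by case=> _ fh _ _; exact/leW_mono/le_mono. Qed.

Lemma homeo01_0 f : oriented_homeo01 f -> f 0 = 0.
Proof.
move=> fH; have fm := homeo01_mono fH; case: fH => fout _ _ [g [_ _ gK]].
case: (ltrgtP (f 0) 0) => // f0.
- by have := fm (f 0) 0; rewrite (fout (f 0)) ?ltxx ?f0 // in_itv /= leNgt f0.
- have: ~~ (g 0 \in `[0, 1]).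
    apply/negP; rewrite in_itv /= => /andP[g0 _].
    by move: g0; rewrite leNgt -fm gK f0.
  by move=> /fout; rewrite gK => g0; move: f0 (gK 0); rewrite -g0 => + e; rewrite e ltxx.
Qed.

Lemma homeo01_1 f : oriented_homeo01 f -> f 1 = 1.
Proof.
move=> fH; have fm := homeo01_mono fH; case: fH => fout _ _ [g [_ _ gK]].
case: (ltrgtP (f 1) 1) => // f1.
- have: ~~ (g 1 \in `[0, 1]).
    apply/negP; rewrite in_itv /= => /andP[_ g1].
    by move: g1; rewrite leNgt -fm gK f1.
  by move=> /fout; rewrite gK => g1; move: f1 (gK 1); rewrite -g1 => + e; rewrite e ltxx.
- by have := fm 1 (f 1); rewrite (fout (f 1)) ?ltxx ?f1 // in_itv /= andbC leNgt f1.
Qed.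

Lemma homeo01_id : oriented_homeo01 idfun.
Proof.
have idc : continuous (idfun : R -> R) by move=> x; exact: cvg_id.
by split => //; exists idfun.
Qed.

Lemma homeo01_comp f g :
  oriented_homeo01 f -> oriented_homeo01 g -> oriented_homeo01 (f \o g).
Proof.
move=> [fo fh fc [f' [f'c fK f'K]]] [go gh gc [g' [g'c gK g'K]]]; split.
- by move=> x xn /=; rewrite go // fo.
- by move=> x y xy /=; exact/fh/gh.
- by move=> x; apply: continuous_comp; [exact: gc|exact: fc].
- exists (g' \o f'); split.
  + by move=> x; apply: continuous_comp; [exact: f'c|exact: g'c].
  + by move=> x /=; rewrite fK.
  + by move=> x /=; rewrite g'K.
Qed.

Lemma homeo01_inv f g : oriented_homeo01 f -> continuous g -> cancel f g ->
  cancel g f -> oriented_homeo01 g.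
Proof.
move=> fH gc fK gK; have fm := homeo01_mono fH; case: (fH) => fo _ fc _; split.
- by move=> x xn; rewrite -{1}(fo x xn) fK.
- by move=> x y xy; rewrite -fm !gK.
- exact: gc.
- by exists f.
Qed.

(* Elements of F preserve and reflect dyadicity in [0,1]. *)
Lemma pl_dyadic f x : oriented_homeo01 f -> dyadic_piecewise_linear f ->
  0 <= x <= 1 -> dyadic (f x) <-> dyadic x.
Proof.
move=> fH [B [Bd fB]].
have [n] := ubnP (count (fun c => c < x) B).
elim: n x => // n IH x; rewrite ltnS => cx /andP[x0 x1].
have key a : 0 <= a -> a < x -> dyadic a -> dyadic (f a) ->
    (forall c, c \in B -> ~~ (a < c < x)) -> dyadic (f x) <-> dyadic x.
  move=> a0 ax da dfa aB; have [k fk] := fB a x a0 ax x1 aB.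
  have fxE : f x = f a + 2 ^ k * (x - a) by apply: fk; rewrite lexx ltW.
  split=> d.
  - have -> : x = a + 2 ^ (- k) * (f x + - f a).
      rewrite fxE addrAC subrr add0r mulrA -expfzDr // addNr expr0z mul1r.
      by rewrite addrC subrK.
    apply: dyadicD => //; apply: dyadicM; first exact: dyadicXz.
    by apply: dyadicD => //; exact: dyadicN.
  - rewrite fxE; apply: dyadicD => //; apply: dyadicM; first exact: dyadicXz.
    by apply: dyadicD => //; exact: dyadicN.
have [->|xn0] := eqVneq x 0; first by rewrite (homeo01_0 fH).
have {xn0}xp : 0 < x by rewrite lt_def xn0.
pose m := \big[Order.max/0]_(c <- B | c < x) c.
have mge c : c \in B -> c < x -> c <= m.
  by move=> cB cx'; apply: le_bigmax_seq.
have m0 : 0 <= m by exact: bigmax_ge_id.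
have [mE|[mB mx]] : m = 0 \/ (m \in B /\ m < x).
  rewrite /m big_seq_cond; elim/big_ind : _ => [|u v [->|[uB ux]] [->|[vB vx]]|c /andP[cB cx']];
    [by left| | | | |by right]; rewrite ?maxxx; try by left.
  - by rewrite /Order.max; case: ifP; [right|left].
  - by rewrite /Order.max; case: ifP; [left|right].
  - by rewrite /Order.max; case: ifP; right.
all: have mgap c : c \in B -> ~~ (m < c < x) by
  move=> cB; apply/negP => /andP[mc cx']; move: mc; rewrite ltNge mge.
- apply: (key m) => //; rewrite ?mE // ?(homeo01_0 fH); exact: dyadic0.
- have [mI md] := Bd _ mB.
  apply: (key m) => //; apply/IH => //; last first.
    by case/andP: mI => /ltW -> /ltW ->.
  apply: leq_trans cx; rewrite -!sum1_count.
  rewrite [X in (_ < X)%N](bigID (fun c => c < m)) /=.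
  rewrite [X in (X < _)%N](eq_bigl (fun c => (c < x) && (c < m))); last first.
    by move=> c; case: (ltP c m) => [cm|]; rewrite ?andbF // (lt_trans cm mx).
  rewrite -[X in (X < _)%N]addn0 ltn_add2l sum1_count -has_count.
  by apply/hasP; exists m => //; rewrite mx ltxx.
Qed.

Lemma pl_id : dyadic_piecewise_linear idfun.
Proof.
exists [::]; split=> // a b _ _ _ _; exists 0 => x _.
by rewrite expr0z mul1r addrC subrK.
Qed.

Lemma pl_comp f g : oriented_homeo01 f -> oriented_homeo01 g ->
  dyadic_piecewise_linear f -> dyadic_piecewise_linear g ->
  dyadic_piecewise_linear (f \o g).
Proof.
move=> fH gH fP gP; have gm := homeo01_mono gH.
have g0 := homeo01_0 gH; have g1 := homeo01_1 gH.
have gPL := gP.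
case: fP => Bf [Bfd fB]; case: gP => Bg [Bgd gB].
have [_ gh _ [g' [_ gK g'K]]] := gH.
have gle := le_mono gh.
exists (Bg ++ map g' Bf); split=> [c|a b a0 ab b1 nc].
- rewrite mem_cat => /orP[/Bgd //|/mapP[d dB ->]].
  have [dI dd] := Bfd _ dB.
  have cI : 0 < g' d < 1 by rewrite -(gm 0) -(gm _ 1) g0 g1 g'K.
  split=> //; apply/(pl_dyadic gH gPL); last by rewrite g'K.
  by case/andP: cI => /ltW -> /ltW ->.
- have [|k gk] := gB a b a0 ab b1.
    by move=> c cB; apply: nc; rewrite mem_cat cB.
  have [||||l fl] := fB (g a) (g b).
  + by rewrite -g0 gle.
  + by rewrite gm.
  + by rewrite -g1 gle.
  + move=> d dB; rewrite -[d]g'K !gm; apply: nc.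
    by rewrite mem_cat map_f ?orbT.
  exists (l + k) => x xab /=.
  rewrite (fl (g x)) ?gle // (gk x) // expfzDr //.
  by rewrite [g a + _]addrC addrK mulrA.
Qed.

Lemma pl_inv f g : oriented_homeo01 f -> dyadic_piecewise_linear f ->
  continuous g -> cancel f g -> cancel g f -> dyadic_piecewise_linear g.
Proof.
move=> fH fP gc fK gK; have gH := homeo01_inv fH gc fK gK.
have fm := homeo01_mono fH; have gm := homeo01_mono gH.
have f0 := homeo01_0 fH; have f1 := homeo01_1 fH.
have g0 := homeo01_0 gH; have g1 := homeo01_1 gH.
have fPL := fP; case: fP => B [Bd fB].
have [_ gh _ _] := gH; have gle := le_mono gh.
exists (map f B); split=> [c /mapP[d dB ->]|a b a0 ab b1 nc].
- have [dI dd] := Bd _ dB; split.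
    by rewrite -(gm 0) -(gm _ 1) g0 g1 fK.
  by apply/(pl_dyadic fH fPL) => //; case/andP: dI => /ltW -> /ltW ->.
- have [||||k fk] := fB (g a) (g b).
  + by rewrite -g0 gle.
  + by rewrite gm.
  + by rewrite -g1 gle.
  + by move=> d dB; rewrite -[d]fK !gm; apply: nc; rewrite map_f.
  exists (- k) => x xab.
  have := fk (g x); rewrite !gle !gK => /(_ xab) xE.
  rewrite [in X in _ * X]xE [a + _]addrC addrK mulrA -expfzDr // addNr expr0z mul1r.
  by rewrite [RHS]addrC subrK.
Qed.

Definition thompson_one : thompsonF := ThompsonF homeo01_id pl_id.

Definition thompson_mul (f g : thompsonF) : thompsonF :=
  ThompsonF (homeo01_comp (thompson_homeo f) (thompson_homeo g))
            (pl_comp (thompson_homeo f) (thompson_homeo g)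
                     (thompson_pl f) (thompson_pl g)).

Lemma thompson_inv_subproof (f : thompsonF) :
  {g : thompsonF | cancel f g /\ cancel g f}.
Proof.
apply: cid; have [_ _ _ [g [gc fK gK]]] := thompson_homeo f.
by exists (ThompsonF (homeo01_inv (thompson_homeo f) gc fK gK)
                     (pl_inv (thompson_homeo f) (thompson_pl f) gc fK gK)).
Qed.

Definition thompson_inv (f : thompsonF) : thompsonF :=
  sval (thompson_inv_subproof f).

Lemma thompson_mulA : associative thompson_mul.
Proof. by move=> f g h; apply: thompsonF_eq. Qed.

Lemma thompson_mul1 : left_id thompson_one thompson_mul.
Proof. by move=> f; apply: thompsonF_eq. Qed.

Lemma thompson_mulr1 : right_id thompson_one thompson_mul.
Proof. by move=> f; apply: thompsonF_eq. Qed.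

Lemma thompson_mulV : left_inverse thompson_one thompson_inv thompson_mul.
Proof.
move=> f; apply: thompsonF_eq => x /=; rewrite /thompson_inv.
by case: thompson_inv_subproof => g [/= fK _]; exact: fK.
Qed.

Lemma thompson_mulrV : right_inverse thompson_one thompson_inv thompson_mul.
Proof.
move=> f; apply: thompsonF_eq => x /=; rewrite /thompson_inv.
by case: thompson_inv_subproof => g [/= _ gK]; exact: gK.
Qed.

HB.instance Definition _ := gen_eqMixin thompsonF.
HB.instance Definition _ := gen_choiceMixin thompsonF.
HB.instance Definition _ := isGroup.Build thompsonF thompson_mulA
  thompson_mul1 thompson_mulr1 thompson_mulV thompson_mulrV.

Definition right_derive f (a : R) : R :=
  lim ((f (a + h) - f a) / h @[h --> 0^'+]).

Definition left_derive f (a : R) : R :=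
  lim ((f (a + h) - f a) / h @[h --> 0^'-]).

(* Rounding is harmless: this is only used on powers of 2. *)
Definition log2 (y : R) : int := Num.floor (ln y / ln 2).

Definition thompson_pi (f : thompsonF) : Zgrp * Zgrp :=
  (log2 (right_derive f 0), log2 (left_derive f 1)).

Lemma log2_exprz (k : int) : log2 (2 ^ k) = k.
Proof.
have l2 : ln (2 : R) != 0 by rewrite gt_eqF // ln_gt0 // ltr1n.
rewrite /log2 -powR_intmul // ln_powR mulfK //; exact: intrKfloor.
Qed.

Lemma right_derive_thompson (f : thompsonF) :
  right_derive f 0 = 2 ^ (thompson_pi f).1.
Proof.
suff [k fk] : exists k : int, right_derive f 0 = 2 ^ k.
  by rewrite /thompson_pi /= fk log2_exprz.
have [B [Bd fB]] := thompson_pl f.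
pose m : R := \big[Order.min/1]_(c <- B) c.
have m1 : m <= 1 by exact: bigmin_le_id.
have m0 : 0 < m.
  rewrite /m big_seq; elim/big_ind : _ => // [u v u0 v0|c /Bd[/andP[]//]].
  by rewrite lt_min u0.
have [c cB|k fk] := fB 0 m (lexx _) m0 m1.
  by apply/negP => /andP[_]; rewrite ltNge ge_bigmin_seq.
exists k; apply/cvg_lim => //; apply: cvg_near_cst; near=> h.
have h0 : 0 < h by near: h; exact: nbhs_right_gt.
have hm : h <= m by near: h; exact: nbhs_right_le.
rewrite add0r (fk h) ?hm ?(ltW h0) // [f 0 + _]addrC addrK subr0 mulfK //.
Unshelve. all: end_near. Qed.

Lemma left_derive_thompson (f : thompsonF) :
  left_derive f 1 = 2 ^ (thompson_pi f).2.
Proof.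
suff [k fk] : exists k : int, left_derive f 1 = 2 ^ k.
  by rewrite /thompson_pi /= fk log2_exprz.
have [B [Bd fB]] := thompson_pl f.
pose m : R := \big[Order.max/0]_(c <- B) c.
have m0 : 0 <= m by exact: bigmax_ge_id.
have m1 : m < 1.
  rewrite /m big_seq; elim/big_ind : _ => // [u v u1 v1|c /Bd[/andP[]//]].
  by rewrite gt_max u1.
have [c cB|k fk] := fB m 1 m0 m1 (lexx _).
  by apply/negP => /andP[+ _]; rewrite ltNge le_bigmax_seq.
exists k; apply/cvg_lim => //; apply: cvg_near_cst; near=> h.
have h0 : h < 0 by near: h; exact: nbhs_left_lt.
have hm : m - 1 <= h by near: h; apply: nbhs_left_ge; rewrite subr_lt0.
rewrite (fk (1 + h)); last by rewrite -lerBlDl hm gerDl ltW.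
rewrite (fk 1) ?lexx ?(ltW m1) //.
have hn0 : h != 0 by rewrite lt_eqF.
by field.
Unshelve. all: end_near. Qed.

End Thompson.

(* Main.v *)
(* A common co-generator [y] with [pi y = +-(1, 1)] has a fixed point in (0, 1)
   by the intermediate value theorem; an [x] fixing the same point cannot
   generate F together with [y].

   Conversely, [x] and [y] generate F as soon as [pi x] and [pi y] generate Z^2
   and the subgroup H generated by [x] and [y] contains the kernel of [pi].  For
   this it suffices that H contains all the elements supported in one dyadic
   window [[A, A + D]] meeting every H-orbit; and for that it suffices to find in
   H a map [u] that is the identity on [[0, A]] and doubles the left half of the
   window, and a map [w] that is the identity on [[A + D, 1]] and doubles the
   right half.

   In the bulk of an interval the map [y] is a translation by a tiny step [z].
   Comparing [y] with [x] near the end 0 yields [u], comparing them near 1 yields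
   [w], and powers of [y] bring the two halves together.  If every point is fixed
   by some element of S, then some element of S has slope 1 at 0 and some has
   slope 1 at 1, so the only candidates for [pi y] are [(+-1, +-1)]; when
   [(1, -1)] is one, a single translation of (0, 1) works for [y].  If some point
   is moved by all of S, then so is some dyadic point [p]; [y] is glued at [p]
   from two such translations, with a step on [[0, p]] that is tiny compared to
   the one on [[p, 1]], and [x] connects the two sides of [p]. *)
Require Import Defs.
From mathcomp Require Import all_boot all_order all_algebra.
From mathcomp Require Import all_classical all_reals all_analysis.
From mathcomp Require Import ring lra zify.

Set Implicit Arguments.
Unset Strict Implicit.
Unset Printing Implicit Defensive.

Import Order.TTheory GRing.Theory Num.Theory.
Import numFieldNormedType.Exports.
Local Open Scope classical_set_scope.
Local Open Scope ring_scope.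

(** * Germs and the abelianization *)

(** One [y] has to serve every [x] in S. Its shape is therefore prescribed in advance and only its
    step [z = 2 ^- k] is adjusted: each [x] asks for [k] large, and finiteness of S gives a common
    [k]. What is known about [x] and [y] together is that the determinant of [pi x] and [pi y] is a
    unit. If [y] has slope 1 at 0, then [x] has slope 2 or 1/2 there; if [x] has slope 1 at 0, then
    [y] has not. The first half-window is obtained by cancelling germs when [x] has slope different
    from 1 at 0. The obstacle is an [x] that is trivial near 0: it has no germ to compare. The break
    then comes from the other end of the translation, where [y] contracts towards its fixed point
    with slope 1/2; powers of [y] carry this break back to the first break of [x]. That needs an
    element of H that is not trivial at the fixed point. For [(1, -1)] the fixed point is 1, and the
    determinant forces slope 2 or 1/2 there; in the glued case it is [p], which [x] moves. The two
    half-windows arise at unrelated places and must be fitted together, so all positions are kept on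
    the grid of mesh [z]. *)

Section Subgroups.
Local Open Scope group_scope.
Variable G : groupType.
Implicit Types (A H : set G) (x y : G).

Lemma is_subgroup_generated A : is_subgroup (generated A).
Proof.
split=> [H [[H1 _ _] _]|x y Ax Ay H HA|x Ax H HA] //.
- by case: (HA) => -[_ HM _] _; apply: HM; [exact: Ax|exact: Ay].
- by case: (HA) => -[_ _ HV] _; apply: HV; exact: Ax.
Qed.

Lemma generated_sub A H : is_subgroup H -> A `<=` H -> generated A `<=` H.
Proof. by move=> HH AH x Ax; exact: Ax. Qed.

Lemma mem_generated A x : A x -> generated A x.
Proof. by move=> Ax H [_ AH]; exact: AH. Qed.

Lemma is_subgroupX H x n : is_subgroup H -> H x -> H (x ^+ n).
Proof.
move=> [H1 HM _] Hx; elim: n => [|n IH]; first by rewrite expg0.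
by rewrite expgS; exact: HM.
Qed.

Lemma cogeneratorV x y : cogenerator x y -> cogenerator x y^-1.
Proof.
move=> xy; apply/seteqP; split=> // g _.
have gxy : generated [set x; y] g by rewrite xy.
have HG := is_subgroup_generated [set x; y^-1].
apply: generated_sub gxy => //; have [_ _ HV] := HG.
move=> _ [->|->]; first by refine (mem_generated _); left.
by rewrite -[X in generated _ X]invgK; refine (HV _ (mem_generated _)); right.
Qed.

End Subgroups.

Section Basics.
Variable R : realType.
Implicit Types (f g h : thompsonF R) (a b c s t v e : R).

Lemma thompson_mulE f g s : (f * g)%g s = f (g s).
Proof. by []. Qed.

Lemma thompson_oneE s : (1%g : thompsonF R) s = s.
Proof. by []. Qed.

Lemma thompsonK f : cancel f (f^-1)%g.
Proof. by move=> s; rewrite -thompson_mulE mulVg. Qed.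

Lemma thompsonKV f : cancel (f^-1)%g f.
Proof. by move=> s; rewrite -thompson_mulE mulgV. Qed.

Lemma thompson_lt f : {mono f : s t / s < t}.
Proof. exact/homeo01_mono/thompson_homeo. Qed.

Lemma thompson_le f : {mono f : s t / s <= t}.
Proof. by move=> s t; rewrite !leNgt thompson_lt. Qed.

Lemma thompson_inj f : injective f.
Proof. exact: can_inj (thompsonK f). Qed.

Lemma thompson_out f s : ~~ (0 < s < 1) -> f s = s.
Proof.
have fH := thompson_homeo f.
have [->|s0] := eqVneq s 0; first by rewrite (homeo01_0 fH).
have [->|s1] := eqVneq s 1; first by rewrite (homeo01_1 fH).
case: fH => fo _ _ _ sn; apply: fo; apply: contra sn.
by rewrite in_itv /= !lt_def s0 [1 == s]eq_sym s1.
Qed.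

Lemma thompson0 f : f 0 = 0.
Proof. by apply: thompson_out; rewrite ltxx. Qed.

Lemma thompson1 f : f 1 = 1.
Proof. by apply: thompson_out; rewrite ltxx andbF. Qed.

Lemma thompson_gt0 f s : (0 < f s) = (0 < s).
Proof. by rewrite -{1}(thompson0 f) thompson_lt. Qed.

Lemma thompson_lt1 f s : (f s < 1) = (s < 1).
Proof. by rewrite -{1}(thompson1 f) thompson_lt. Qed.

Lemma thompson_invE f s t : f s = t -> (f^-1)%g t = s.
Proof. by move=> <-; rewrite thompsonK. Qed.

Lemma dyadic_natr (n : nat) : dyadic (n%:R : R).
Proof. by exists n%:Z, 0%N; rewrite expr0 divr1. Qed.

Lemma dyadicVX (n : nat) : dyadic ((2 : R) ^- n).
Proof. by exists 1, n; rewrite mul1r. Qed.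

Lemma dyadic1 : dyadic (1 : R).
Proof. exact: (dyadic_natr 1). Qed.

Lemma dyadicB s t : dyadic s -> dyadic t -> dyadic (s - t).
Proof. by move=> ds dt; apply: dyadicD => //; exact: dyadicN. Qed.

Lemma thompson_dyadic f s : 0 <= s <= 1 -> dyadic (f s) <-> dyadic s.
Proof. exact: pl_dyadic (thompson_homeo f) (thompson_pl f). Qed.

Lemma right_germ f s : 0 <= s < 1 ->
  exists k e, [/\ 0 < e, s + e <= 1 &
    forall v, 0 <= v <= e -> f (s + v) = f s + 2 ^ k * v].
Proof.
(* [m] below is the next breakpoint to the right of [s]; the default 1 serves when none is left and
   keeps the interval inside [0, 1]. *)
move=> /andP[s0 s1]; have [B [Bd fB]] := thompson_pl f.
pose m : R := \big[Order.min/1]_(c <- B | s < c) c.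
have m1 : m <= 1 by exact: bigmin_le_id.
have ms : s < m.
  by rewrite /m; elim/big_ind : _ => // [u v u0 v0]; rewrite lt_min u0.
have [c cB|k fk] := fB s m s0 ms m1.
  by apply/negP => /andP[sc]; rewrite ltNge ge_bigmin_seq.
exists k, (m - s); split; [lra|lra|move=> v v0].
by rewrite fk; [congr (_ + _ * _); ring|lra].
Qed.

Lemma left_germ f s : 0 < s <= 1 ->
  exists k e, [/\ 0 < e, 0 <= s - e &
    forall v, 0 <= v <= e -> f (s - v) = f s - 2 ^ k * v].
Proof.
move=> /andP[s0 s1]; have [B [Bd fB]] := thompson_pl f.
pose m : R := \big[Order.max/0]_(c <- B | c < s) c.
have m1 : 0 <= m by exact: bigmax_ge_id.
have ms : m < s.
  by rewrite /m; elim/big_ind : _ => // [u v u0 v0]; rewrite gt_max u0.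
have [c cB|k fk] := fB m s m1 ms s1.
  by apply/negP => /andP[+ sc]; rewrite ltNge le_bigmax_seq.
exists k, (s - m); split; [lra|lra|move=> v v0].
by rewrite fk; [rewrite (fk s); [ring|lra]|lra].
Qed.

Lemma exprz_inj2 (k l : int) : (2 : R) ^ k = 2 ^ l -> k = l.
Proof. by move=> e; rewrite -(log2_exprz R k) e log2_exprz. Qed.

Lemma exprz2_gt0 (k : int) : 0 < (2 : R) ^ k.
Proof. by rewrite exprz_gt0. Qed.

(** This and its mirror image let [thompson_pi] be read off linear germs, so that later arguments
    need no limits. *)
Lemma thompson_pi1_germ f k e : 0 < e ->
  (forall s, 0 <= s <= e -> f s = 2 ^ k * s) -> (thompson_pi f).1 = k.
Proof.
move=> e0 fk; apply: exprz_inj2; rewrite -right_derive_thompson.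
apply/cvg_lim => //; apply: cvg_near_cst; near=> h.
have h0 : 0 < h by near: h; exact: nbhs_right_gt.
have hm : h <= e by near: h; exact: nbhs_right_le.
by rewrite thompson0 add0r subr0 fk ?hm ?(ltW h0) // mulfK //; exact: lt0r_neq0.
Unshelve. all: end_near. Qed.

Lemma thompson_pi2_germ f k e : 0 < e ->
  (forall s, 0 <= s <= e -> f (1 - s) = 1 - 2 ^ k * s) -> (thompson_pi f).2 = k.
Proof.
move=> e0 fk; apply: exprz_inj2; rewrite -left_derive_thompson.
apply/cvg_lim => //; apply: cvg_near_cst; near=> h.
have h0 : h < 0 by near: h; exact: nbhs_left_lt.
have hm : - e <= h by near: h; apply: nbhs_left_ge; rewrite oppr_lt0.
have -> : 1 + h = 1 - (- h) by ring.
rewrite thompson1 fk; last lra.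
have hn0 : h != 0 by rewrite lt_eqF.
by field.
Unshelve. all: end_near. Qed.

Lemma thompson_pi1P f : exists2 e, 0 < e <= 1 &
  forall s, 0 <= s <= e -> f s = 2 ^ (thompson_pi f).1 * s.
Proof.
have [|k [e [e0 e1 fe]]] := @right_germ f 0; first lra.
have fk s : 0 <= s <= e -> f s = 2 ^ k * s.
  by move=> /fe; rewrite add0r thompson0 add0r.
by exists e => [|s]; [lra|rewrite (thompson_pi1_germ e0 fk); exact: fk].
Qed.

Lemma thompson_pi2P f : exists2 e, 0 < e <= 1 &
  forall s, 0 <= s <= e -> f (1 - s) = 1 - 2 ^ (thompson_pi f).2 * s.
Proof.
have [|k [e [e0 e1 fe]]] := @left_germ f 1; first lra.
have fk s : 0 <= s <= e -> f (1 - s) = 1 - 2 ^ k * s.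
  by move=> /fe; rewrite thompson1.
by exists e => [|s]; [lra|rewrite (thompson_pi2_germ e0 fk); exact: fk].
Qed.

Lemma thompson_piM f g : thompson_pi (f * g)%g = (thompson_pi f * thompson_pi g)%g.
Proof.
have -> : (thompson_pi f * thompson_pi g)%g = ((thompson_pi f).1 + (thompson_pi g).1,
  (thompson_pi f).2 + (thompson_pi g).2) by [].
rewrite [LHS]surjective_pairing; congr pair.
- have := thompson_pi1P f; move: (thompson_pi f).1 => k [e /andP[e0 _] fe].
  have := thompson_pi1P g; move: (thompson_pi g).1 => l [d /andP[d0 _] gd].
  have lp := exprz2_gt0 l.
  (* The germ of [g] must land where [f] is linear, hence the bound [e / 2 ^ l]. *)
  apply: (@thompson_pi1_germ _ _ (Num.min d (e / 2 ^ l))).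
    by rewrite lt_min d0 divr_gt0.
  move=> s; rewrite le_min ler_pdivlMr // => /and3P[s0 sd se].
  rewrite thompson_mulE gd ?s0 // fe ?expfzDr //; first by rewrite mulrA.
  by rewrite mulr_ge0 ?(ltW lp) //= mulrC.
- have := thompson_pi2P f; move: (thompson_pi f).2 => k [e /andP[e0 _] fe].
  have := thompson_pi2P g; move: (thompson_pi g).2 => l [d /andP[d0 _] gd].
  have lp := exprz2_gt0 l.
  apply: (@thompson_pi2_germ _ _ (Num.min d (e / 2 ^ l))).
    by rewrite lt_min d0 divr_gt0.
  move=> s; rewrite le_min ler_pdivlMr // => /and3P[s0 sd se].
  rewrite thompson_mulE gd ?s0 // fe ?expfzDr //; first by rewrite mulrA.
  by rewrite mulr_ge0 ?(ltW lp) //= mulrC.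
Qed.

Lemma thompson_pi_one : thompson_pi (1%g : thompsonF R) = 1%g.
Proof.
by apply: (mulgI (thompson_pi (1%g : thompsonF R))); rewrite -thompson_piM !mulg1.
Qed.

Lemma thompson_piV f : thompson_pi (f^-1)%g = ((thompson_pi f)^-1)%g.
Proof. by apply: (mulgI (thompson_pi f)); rewrite -thompson_piM !mulgV thompson_pi_one. Qed.

End Basics.

(** * Gluing piecewise linear maps *)

Section Construct.
Variable R : realType.
Implicit Types (f g h : thompsonF R) (a b c s t v e : R).

(** A strictly increasing surjection has no jumps. Continuity of maps defined by cases thus follows
    from their order properties. *)
Lemma mono_can_continuous (f g : R -> R) :
  {mono f : s t / s < t} -> cancel g f -> continuous f.
Proof.
move=> fm gK s; apply/cvgrPdist_lt => e e0; near=> t.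
have ft1 : f s - e < f t.
  rewrite -[_ - e]gK fm; near: t; apply: lt_nbhsr.
  by rewrite -fm gK ltrBlDr ltrDl.
have ft2 : f t < f s + e.
  rewrite -[_ + e]gK fm; near: t; apply: lt_nbhsl.
  by rewrite -fm gK ltrDl.
by rewrite distrC ltr_distl ft1.
Unshelve. all: end_near. Qed.

Lemma homeo01_of_mono (f g : R -> R) :
  (forall s, s \notin `[0, 1] -> f s = s) -> {mono f : s t / s < t} ->
  cancel f g -> cancel g f -> oriented_homeo01 f.
Proof.
move=> fo fm fK gK; split=> //; first by move=> s t; rewrite fm.
- exact: mono_can_continuous fm gK.
- exists g; split=> //; apply: mono_can_continuous fK.
  by move=> s t; rewrite -fm !gK.
Qed.

(** * Reflection of the unit interval *)

Section Flip.
Variable f : thompsonF R.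

Lemma flip_homeo : oriented_homeo01 (fun s => 1 - f (1 - s)).
Proof.
apply: (@homeo01_of_mono _ (fun s => 1 - (f^-1)%g (1 - s))).
- move=> s sn; rewrite thompson_out; first by ring.
  by apply: contra sn => s01; rewrite in_itv /=; lra.
- by move=> s t; rewrite ltrD2l ltrN2 thompson_lt ltrD2l ltrN2.
- by move=> s; rewrite subKr thompsonK subKr.
- by move=> s; rewrite subKr thompsonKV subKr.
Qed.

Lemma flip_pl : dyadic_piecewise_linear (fun s => 1 - f (1 - s)).
Proof.
have [B [Bd fB]] := thompson_pl f.
exists [seq 1 - c | c <- B]; split.
  move=> _ /mapP[c /Bd[c01 dc] ->]; split; first lra.
  exact: dyadicB (dyadic1 R) dc.
move=> a b a0 ab b1 nB.
have [||||k fk] := fB (1 - b) (1 - a); [lra|lra|lra| |exists k => x x1].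
  by move=> c cB; have := nB (1 - c) (map_f _ cB); apply: contra; lra.
by rewrite (fk (1 - x)) 1?(fk (1 - a)); [ring|lra|lra].
Qed.

(** Conjugation by the reflection exchanges the two ends; every construction at 0 is reused at 1
    through it. *)
Definition flip : thompsonF R := ThompsonF flip_homeo flip_pl.

Lemma flipE s : flip s = 1 - f (1 - s). Proof. by []. Qed.

End Flip.

Lemma flipK : involutive flip.
Proof. by move=> f; apply: thompsonF_eq => s; rewrite !flipE !subKr. Qed.

Lemma flipM f g : flip (f * g)%g = (flip f * flip g)%g.
Proof. by apply: thompsonF_eq => s; rewrite thompson_mulE !flipE subKr. Qed.

Lemma flip1 : flip 1%g = 1%g.
Proof. by apply: thompsonF_eq => s; rewrite flipE !thompson_oneE subKr. Qed.

Lemma flipV f : flip (f^-1)%g = ((flip f)^-1)%g.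
Proof. by apply: (mulgI (flip f)); rewrite -flipM !mulgV flip1. Qed.

Lemma flip_pi f : thompson_pi (flip f) = ((thompson_pi f).2, (thompson_pi f).1).
Proof.
rewrite [LHS]surjective_pairing; congr pair.
- have := thompson_pi2P f; move: (thompson_pi f).2 => k [e /andP[e0 _] fe].
  by apply: (thompson_pi1_germ e0) => s /fe fs; rewrite flipE fs subKr.
- have := thompson_pi1P f; move: (thompson_pi f).1 => k [e /andP[e0 _] fe].
  by apply: (thompson_pi2_germ e0) => s /fe fs; rewrite flipE subKr fs.
Qed.

Lemma flip_pi1 f : (thompson_pi (flip f)).1 = (thompson_pi f).2.
Proof. by rewrite flip_pi. Qed.

Lemma flip_pi2 f : (thompson_pi (flip f)).2 = (thompson_pi f).1.
Proof. by rewrite flip_pi. Qed.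

Lemma is_subgroup_flip (H : set (thompsonF R)) :
  is_subgroup H -> is_subgroup [set f | H (flip f)].
Proof.
move=> [H1 HM HV]; split=> [|f g Hf Hg|f Hf] /=.
- by rewrite flip1.
- by rewrite flipM; exact: HM.
- by rewrite flipV; exact: HV.
Qed.

(* [pl2 f a b c d]: on [a, b], f is an increasing dyadic piecewise linear
   bijection onto [c, d]; its values elsewhere are irrelevant. *)
Definition pl2 (f : R -> R) a b c d : Prop :=
  [/\ a < b, f a = c /\ f b = d,
    forall x y, a <= x -> x < y -> y <= b -> f x < f y,
    forall v, c <= v <= d -> exists2 x, a <= x <= b & f x = v
  & exists B : seq R, (forall p, p \in B -> a < p < b /\ dyadic p) /\
    (forall x y, a <= x -> x < y -> y <= b ->
       (forall p, p \in B -> ~~ (x < p < y)) ->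
       exists k : int, forall v, x <= v <= y -> f v = f x + 2 ^ k * (v - x))].

(** The gluing point becomes a possible breakpoint, which is why it has to be dyadic. *)
Lemma pl2_glue (f g : R -> R) a b c a' b' c' : dyadic b ->
  pl2 f a b a' b' -> pl2 g b c b' c' ->
  pl2 (fun x => if x <= b then f x else g x) a c a' c'.
Proof.
move=> db [ab [fa fb] fm fs [B [BI fB]]] [bc [gb gc] gm gs [C [CI gC]]].
have fle x : a <= x -> x <= b -> f x <= b'.
  move=> ax; rewrite le_eqVlt => /orP[/eqP ->|xb]; first by rewrite fb.
  by rewrite -fb ltW //; exact: fm.
have glt x : b < x -> x <= c -> b' < g x by move=> *; rewrite -gb gm.
split.
- exact: lt_trans bc.
- by rewrite (ltW ab) leNgt bc.
- move=> x y ax xy yc; case: (leP x b) => xb; case: (leP y b) => yb.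
  + exact: fm.
  + by apply: (le_lt_trans (fle _ ax xb)); exact: glt.
  + lra.
  + by apply: gm => //; exact: ltW.
- move=> v /andP[av vc]; case: (leP v b') => vb.
  + have [|x /andP[ax xb] xv] := fs v; first by rewrite av.
    by exists x; [rewrite ax; lra|rewrite xb].
  + have [|x /andP[bx xc] xv] := gs v; first by rewrite vc ltW.
    exists x; first by rewrite xc; lra.
    by case: leP => // xb; rewrite -xv; have -> : x = b by [lra]; rewrite fb gb.
- exists (B ++ b :: C); split=> [p|x y ax xy yc nB].
    rewrite mem_cat inE => /or3P[/BI[]|/eqP ->|/CI[]]; split=> //; lra.
  have := nB b; rewrite mem_cat mem_head orbT => /(_ isT) nb.
  have [yb|yb] := leP y b.
  + have [|k fk] := fB x y ax xy yb.
      by move=> p pB; apply: nB; rewrite mem_cat pB.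
    exists k => v xv; rewrite !ifT; [exact: fk|lra|lra].
  + have bx : b <= x by move: nb; rewrite yb andbT -leNgt.
    have [|k gk] := gC x y bx xy yc.
      by move=> p pC; apply: nB; rewrite mem_cat inE pC !orbT.
    exists k => v xv.
    have gE w : b <= w -> (if w <= b then f w else g w) = g w.
      by move=> bw; case: leP => // wb; have -> : w = b by [lra]; rewrite fb gb.
    rewrite !gE //; [exact: gk|lra].
Qed.

Lemma pl2_affine a b c (k : int) : a < b ->
  pl2 (fun x => c + 2 ^ k * (x - a)) a b c (c + 2 ^ k * (b - a)).
Proof.
move=> ab; have [m mE] : exists m : R, m = 2 ^ k by exists (2 ^ k).
have k0 : 0 < m by rewrite mE exprz2_gt0.
rewrite -mE.
split=> //.
- by split=> //; ring.
- by move=> x y _ xy _; rewrite ltrD2l ltr_pM2l // ltrD2r.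
- move=> v /andP[cv vd]; exists (a + (v - c) / m); last by field; exact: lt0r_neq0.
  by rewrite lerDl divr_ge0 ?subr_ge0 ?(ltW k0) //= -lerBrDl ler_pdivrMr //; lra.
- by exists [::]; split=> // x y _ _ _ _; exists k => v _; rewrite -mE; ring.
Qed.

Lemma pl2_restrict f a b : 0 <= a -> a < b -> b <= 1 ->
  pl2 f a b (f a) (f b).
Proof.
move=> a0 ab b1; split=> //.
- by move=> x y _ xy _; rewrite thompson_lt.
- move=> v; rewrite -{1 2}[v](thompsonKV f) !thompson_le => ?.
  by exists ((f^-1)%g v) => //; rewrite thompsonKV.
- have [B [BI fB]] := thompson_pl f.
  exists [seq p <- B | a < p < b]; split=> [p|x y ax xy yb nB].
    by rewrite mem_filter => /andP[-> /BI[]].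
  apply: fB => //; [lra|lra|move=> c cB; apply/negP => xcy].
  by have := nB c; rewrite mem_filter cB xcy andbT => /(_ _)/negP; apply => //; lra.
Qed.

Lemma thompson_of_pl2 (f : R -> R) : pl2 f 0 1 0 1 ->
  exists g, forall x, 0 <= x <= 1 -> g x = f x.
Proof.
move=> [_ [f0 f1] fm fs [B [BI fB]]].
pose h x : R := if 0 <= x <= 1 then f x else x.
have hm : {homo h : x y / x < y}.
  have fle x : 0 <= x -> x <= 1 -> 0 <= f x <= 1.
    rewrite le_eqVlt => /orP[/eqP <-|x0]; first by rewrite f0 lexx ler01.
    rewrite le_eqVlt => /orP[/eqP ->|x1]; first by rewrite f1 lexx ler01.
    have := fm 0 x (lexx 0) x0 (ltW x1); have := fm x 1 (ltW x0) x1 (lexx 1).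
    by rewrite f0 f1 => /ltW -> /ltW ->.
  move=> x y xy; rewrite /h.
  case: ifP => [/andP[x0 x1]|/negP xn]; case: ifP => [/andP[y0 y1]|/negP yn] //.
  - exact: fm.
  - by have := fle x x0 x1; case: (ltP 1 y) => ?; [lra|case: yn; lra].
  - by have := fle y y0 y1; case: (ltP x 0) => ?; [lra|case: xn; lra].
have hs y : exists x, h x = y.
  have [y01|yn] := boolP (0 <= y <= 1).
    by have [x x01 xy] := fs y y01; exists x; rewrite /h x01.
  by exists y; rewrite /h (negbTE yn).
have [g hg] := choice hs.
have hmono : {mono h : x y / x < y} by exact/leW_mono/le_mono.
have hK : cancel h g.
  by move=> x; apply: (inc_inj (le_mono hm)); rewrite hg.
have hH : oriented_homeo01 h.
  apply: (homeo01_of_mono _ hmono hK hg) => s.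
  by rewrite in_itv /= /h => /negbTE ->.
have hP : dyadic_piecewise_linear h.
  exists B; split=> // a b a0 ab b1 nB.
  have [k fk] := fB a b a0 ab b1 nB.
  by exists k => x abx; rewrite /h !ifT; [exact: fk|lra|lra].
by exists (ThompsonF hH hP) => x x01 /=; rewrite /h x01.
Qed.

Lemma exprz2S (k : int) : (2 : R) ^ k = 2 ^ (k - 1) + 2 ^ (k - 1).
Proof. by rewrite -{1}(subrK 1 k) expfzDr ?pnatr_eq0 // expr1z mulr_natr. Qed.

Lemma pl2_scale (k l : int) a c : exists f : R -> R,
  pl2 f a (a + 2 ^ k) c (c + 2 ^ l).
Proof.
exists (fun x => c + 2 ^ (l - k) * (x - a)).
have := @pl2_affine a (a + 2 ^ k) c (l - k); rewrite ltrDl exprz2_gt0.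
by rewrite [a + _]addrC addrK -expfzDr ?subrK // [_ + a]addrC; apply.
Qed.

(** Half of the source goes onto the first cell of the target and the induction treats the other
    half, so every slope remains a power of 2. *)
Lemma pl2_stretch (n : nat) (k l : int) a c : dyadic a -> dyadic c -> exists f : R -> R,
  pl2 f a (a + 2 ^ k) c (c + n.+1%:R * 2 ^ l).
Proof.
move=> da dc; elim: n k a c da dc => [|n IH] k a c da dc.
  by rewrite mul1r; exact: pl2_scale.
have [f fP] := pl2_scale (k - 1) l a c.
have da' : dyadic (a + 2 ^ (k - 1)) by apply: dyadicD => //; exact: dyadicXz.
have [g gP] := IH (k - 1) _ _ da' (dyadicD dc (dyadicXz R l)).
eexists; have := pl2_glue da' fP gP.
by rewrite -!addrA -exprz2S mulrSr mulrDl mul1r [2 ^ l + _]addrC; apply.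
Qed.

Lemma pl2_shrink (n : nat) (k l : int) a c : dyadic a -> dyadic c -> exists f : R -> R,
  pl2 f a (a + n.+1%:R * 2 ^ k) c (c + 2 ^ l).
Proof.
move=> da dc; elim: n l a c da dc => [|n IH] l a c da dc.
  by rewrite mul1r; exact: pl2_scale.
have [f fP] := pl2_scale k (l - 1) a c.
have dc' : dyadic (c + 2 ^ (l - 1)) by apply: dyadicD => //; exact: dyadicXz.
have da' := dyadicD da (dyadicXz R k).
have [g gP] := IH (l - 1) _ _ da' dc'.
eexists; have := pl2_glue da' fP gP.
by rewrite -!addrA -exprz2S mulrSr mulrDl mul1r [2 ^ k + _]addrC; apply.
Qed.

(** Cells are matched one to one until one side has a single cell left, which is then stretched or
    shrunk. *)
Lemma pl2_grid (m n : nat) (k : int) a c : dyadic a -> dyadic c -> exists f : R -> R,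
  pl2 f a (a + m.+1%:R * 2 ^ k) c (c + n.+1%:R * 2 ^ k).
Proof.
elim: m n a c => [|m IH] n a c da dc; first by rewrite mul1r; exact: pl2_stretch.
case: n => [|n]; first by rewrite [1%:R * _]mul1r; exact: pl2_shrink.
have [f fP] := pl2_scale k k a c.
have da' := dyadicD da (dyadicXz R k); have dc' := dyadicD dc (dyadicXz R k).
have [g gP] := IH n _ _ da' dc'.
eexists; have := pl2_glue da' fP gP.
rewrite -!addrA [m.+2%:R]mulrSr [n.+2%:R]mulrSr !mulrDl !mul1r.
by rewrite ![2 ^ k + _]addrC; apply.
Qed.

(** The free exponent [M] lets two lengths be written over a common denominator, with numerators
    visibly positive. *)
Lemma dyadic_gt0P v : dyadic v -> 0 < v -> exists (m N : nat),
  forall M : nat, (N <= M)%N -> v = (m.+1 * 2 ^ (M - N))%:R / 2 ^+ M.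
Proof.
move=> [m [n vE]] v0.
have m0 : 0 < m by move: v0; rewrite vE pmulr_lgt0 ?invr_gt0 ?exprn_gt0 // ltr0z.
case: m m0 vE => [[|m]|m] // _ vE; exists m, n => M nM.
rewrite natrM natrX vE -{2}(subnK nM) exprD.
by field; rewrite !expf_neq0.
Qed.

Lemma pl2_ext a b c d : dyadic a -> dyadic b -> dyadic c -> dyadic d ->
  a < b -> c < d -> exists f : R -> R,
  pl2 f a b c d.
Proof.
move=> da db dc dd ab cd.
have [||m [N mE]] := @dyadic_gt0P (b - a); [exact: dyadicB|lra|].
have [||n [P nE]] := @dyadic_gt0P (d - c); [exact: dyadicB|lra|].
have bE := mE _ (leq_maxl N P); have dE := nE _ (leq_maxr N P).
move: (maxn N P) bE dE => M bE dE.
have S q : (q.+1 * 2 ^ (M - N) = (q.+1 * 2 ^ (M - N)).-1.+1)%N.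
  by rewrite prednK // muln_gt0 expn_gt0.
have S' q : (q.+1 * 2 ^ (M - P) = (q.+1 * 2 ^ (M - P)).-1.+1)%N.
  by rewrite prednK // muln_gt0 expn_gt0.
have := @pl2_grid _ _ (- M%:Z) a c da dc => /(_ (m.+1 * 2 ^ (M - N)).-1 (n.+1 * 2 ^ (M - P)).-1).
rewrite -S -S' -exprnN -bE -dE.
by rewrite [a + _]addrC [c + _]addrC !subrK.
Qed.

Lemma pl2_id a b : a < b -> pl2 id a b a b.
Proof.
move=> ab; split=> //; first by move=> v v01; exists v.
exists [::]; split=> // x y _ _ _ _; exists 0 => v _.
by rewrite expr0z mul1r; ring.
Qed.

Lemma thompson_glue f g b : dyadic b -> 0 <= b <= 1 -> f b = b -> g b = b ->
  exists h, forall x, h x = if x <= b then f x else g x.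
Proof.
move=> db; rewrite !le_eqVlt => /andP[/orP[/eqP <-|b0] b1] fb gb.
  exists g => x; case: ifP => // x0; rewrite !thompson_out //; lra.
case/orP: b1 => [/eqP b1|b1].
  exists f => x; case: (leP x b) => // x1; rewrite !thompson_out //; lra.
have := pl2_glue db (pl2_restrict f (lexx 0) b0 (ltW b1)).
have := pl2_restrict g (ltW b0) b1 (lexx 1).
rewrite fb gb thompson0 thompson1 => gP /(_ _ _ _ gP) /thompson_of_pl2[h hE].
exists h => x; have [/hE //|xn] := boolP (0 <= x <= 1).
have xo : ~~ (0 < x < 1) by apply: contra xn => /andP[/ltW -> /ltW ->].
by rewrite !thompson_out // if_same.
Qed.

End Construct.

Local Arguments thompson_fun : simpl never.

(** * Elements supported in a window *)

Section Supported.
Variable R : realType.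
Implicit Types (f g h : thompsonF R) (a b c s t v e : R).

Definition supported a b f := forall s, ~~ (a < s < b) -> f s = s.

Lemma supported_conj a b f h : supported a b f ->
  supported (h a) (h b) (h * f * h^-1)%g.
Proof.
move=> fab s sn; rewrite !thompson_mulE fab ?thompsonKV //.
by rewrite -(thompson_lt h a) -(thompson_lt h _ b) thompsonKV.
Qed.

Lemma supported_sub a b c e f : c <= a -> b <= e -> supported a b f ->
  supported c e f.
Proof. by move=> ca be fab s sn; apply: fab; apply: contra sn; lra. Qed.

End Supported.

(** * Binary trees and standard dyadic subdivisions *)

Inductive bintree := Leaf | Node of bintree & bintree.

(** A leaf is recorded by its path from the root, [false] for left; the list runs from left to
    right. *)
Fixpoint leaves T : seq (seq bool) :=
  if T is Node T1 T2 then map (cons false) (leaves T1) ++ map (cons true) (leaves T2)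
  else [:: [::]].

Fixpoint rightvine n := if n is m.+1 then Node Leaf (rightvine m) else Leaf.

Lemma size_leaves_rightvine n : size (leaves (rightvine n)) = n.+1.
Proof. by elim: n => //= n IH; rewrite size_map IH. Qed.

Section Words.
Variable R : realType.
Implicit Types (x y : R) (b : bool) (w : seq bool).

Definition halve b x : R := if b then (x + 1) / 2 else x / 2.
(** The affine map of [0, 1] onto the standard dyadic interval with address [w]; its values at 0 and
    1 are the endpoints. *)
Definition subinterval w x : R := foldr halve x w.

Lemma subinterval_cat v w x : subinterval (v ++ w) x = subinterval v (subinterval w x).
Proof. by rewrite /subinterval foldr_cat. Qed.

Lemma halve01 b x : 0 <= x <= 1 -> 0 <= halve b x <= 1.
Proof. by case: b; rewrite /halve; lra. Qed.

Lemma subinterval01 w x : 0 <= x <= 1 -> 0 <= subinterval w x <= 1.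
Proof. by elim: w => //= b w IH /IH; exact: halve01. Qed.

Lemma subinterval_lt w x y : x < y -> subinterval w x < subinterval w y.
Proof.
by elim: w => //= b w IH /IH; rewrite -!/(subinterval _ _) /halve; case: b; lra.
Qed.

Lemma subinterval_ends w :
  [/\ 0 <= subinterval w 0, subinterval w 0 < subinterval w 1 & subinterval w 1 <= 1].
Proof.
have /andP[-> _] : 0 <= subinterval w 0 <= 1 by apply: subinterval01; lra.
have /andP[_ ->] : 0 <= subinterval w 1 <= 1 by apply: subinterval01; lra.
by rewrite subinterval_lt ?ltr01.
Qed.

Lemma subinterval_nat m n : (m < 2 ^ n)%N -> exists2 v, size v = n &
  forall x, subinterval v x = (m%:R + x) / 2 ^+ n.
Proof.
elim: n m => [|n IH] m mn.
  exists [::] => // x; move: mn; rewrite expn0 ltnS leqn0 => /eqP ->.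
  by rewrite expr0 add0r divr1.
have n0 : (2 : R) ^+ n != 0 by rewrite expf_neq0.
case: (ltnP m (2 ^ n)%N) => m2.
  have [v vn vE] := IH m m2; exists (false :: v); first by rewrite /= vn.
  by move=> x; rewrite /= -/(subinterval v x) vE exprS /halve; field.
have [|v vn vE] := IH (m - 2 ^ n)%N; first by move: mn; rewrite expnS; lia.
exists (true :: v); first by rewrite /= vn.
move=> x; rewrite /= -/(subinterval v x) vE exprS /halve natrB // natrX.
by field.
Qed.

Lemma leaves_cover T x : 0 <= x <= 1 ->
  exists w y, [/\ w \in leaves T, 0 <= y <= 1 & x = subinterval w y].
Proof.
elim: T x => [|T1 IH1 T2 IH2] x x01; first by exists [::], x.
case: (leP x (1 / 2)) => x2.
  have [|w [y [wT y01 xE]]] := IH1 (2 * x); first lra.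
  exists (false :: w), y; split=> //=; first by rewrite mem_cat map_f.
  by rewrite -/(subinterval w y) -xE /halve; field.
have [|w [y [wT y01 xE]]] := IH2 (2 * x - 1); first lra.
exists (true :: w), y; split=> //=; first by rewrite mem_cat map_f ?orbT.
by rewrite -/(subinterval w y) -xE /halve; field.
Qed.

Fixpoint tiling x (ws : seq (seq bool)) y : Prop :=
  if ws is w :: ws' then subinterval w 0 = x /\ tiling (subinterval w 1) ws' y
  else x = y.

Lemma tiling_cat x y z s t : tiling x s y -> tiling y t z -> tiling x (s ++ t) z.
Proof. by elim: s x => [|w s IH] x /= => [-> //|[-> /IH]]; auto. Qed.

Lemma tiling_map b x y s : tiling x s y ->
  tiling (halve b x) (map (cons b) s) (halve b y).
Proof.
elim: s x => [|w s IH] x /= => [-> //|[<- /IH]].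
by rewrite -!/(subinterval _ _).
Qed.

Lemma tiling_leaves T : tiling 0 (leaves T) 1.
Proof.
elim: T => [|T1 IH1 T2 IH2] //=; apply: (@tiling_cat _ (1 / 2)).
  by have := tiling_map false IH1; rewrite /halve mul0r.
by have := tiling_map true IH2; rewrite /halve add0r -(natrD R 1 1) divff.
Qed.

Lemma subinterval_cons b w x : subinterval (b :: w) x = halve b (subinterval w x).
Proof. by []. Qed.

Lemma tiling_right x ts : 1 / 2 <= x -> all (fun w => w != [::]) ts ->
  tiling x ts 1 -> exists2 r, ts = map (cons true) r & tiling (2 * x - 1) r 1.
Proof.
elim: ts x => [|w ts IH] x x2 /=; first by move=> _ ->; exists [::] => //=; lra.
case: w => // b w /= ts0 [xE]; move: x2; rewrite -{}xE => x2.
have [w0 w01 w1] := subinterval_ends w; move: x2.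
rewrite -!/(subinterval _ _) => x2 wt; case: b x2 wt => x2.
  move=> /IH[|//|r -> rt]; first by rewrite /halve; lra.
  exists (w :: r) => //=; split; first by rewrite /halve; field.
  by move: rt; congr tiling; rewrite /halve; field.
by move: x2; rewrite /halve; lra.
Qed.

(** A standard interval other than [0, 1] cannot have 1/2 in its interior, so the tiling can be cut
    there. *)
Lemma tiling_split x ts : 0 <= x <= 1 / 2 -> all (fun w => w != [::]) ts ->
  tiling x ts 1 -> exists l r, [/\ ts = map (cons false) l ++ map (cons true) r,
    tiling (2 * x) l 1 & tiling 0 r 1].
Proof.
elim: ts x => [|w ts IH] x x01 /=; first by lra.
have [->|xn2] := eqVneq x (1 / 2).
  move=> ts0 wt; have [r rE rt] := @tiling_right _ (w :: ts) (lexx _) ts0 wt.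
  by exists [::], r; split=> //=; [field|move: rt; congr tiling; field].
case: w => // b w /= ts0 [xE]; have [w0 w01 w1] := subinterval_ends w.
move: xE; rewrite -!/(subinterval _ _); case: b => xE.
  have : x < 1 / 2 by rewrite lt_neqAle xn2; lra.
  by move: xE; rewrite /halve; lra.
move=> /IH[|//|l [r [-> lt rt]]]; first by rewrite /halve; lra.
exists (w :: l), r; split=> //=; split; first by rewrite -xE /halve; field.
by move: lt; congr tiling; rewrite /halve; field.
Qed.

(** Induction on the depth: a tiling that uses the empty address is a single leaf, any other one is
    cut at 1/2 into tilings of the two halves. *)
Lemma tiling_tree ts : tiling 0 ts 1 -> exists T, leaves T = ts.
Proof.
have [N] : exists N, all (fun w => size w <= N)%N ts.
  elim: ts => [|w ts [N wN]]; first by exists 0%N.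
  exists (maxn (size w) N) => /=; rewrite leq_maxl /=.
  by apply: sub_all wN => v vN; rewrite (leq_trans vN) ?leq_maxr.
elim: N ts => [|N IH] ts tsN tst.
  case: ts tsN tst => [|w ts] /=; first by move=> _ e; have := @ltr01 R; lra.
  case: w => //= tsN [_]; case: ts tsN => [|v ts] /=; first by exists Leaf.
  by case: v => //= _ [e _]; have := @ltr01 R; lra.
have [ts0|] := boolP (all (fun w => w != [::]) ts).
  have [|l [r [tsE lt rt]]] := @tiling_split 0 ts _ ts0 tst; first by lra.
  move: tsN; rewrite tsE all_cat !all_map => /andP[lN rN].
  rewrite mulr0 in lt; have [T1 T1E] := IH l lN lt.
  have [T2 T2E] := IH r rN rt.
  by exists (Node T1 T2); rewrite /= T1E T2E.
case: ts tst tsN => [|w ts] //= [w0 wt] /andP[_ tsN].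
case: w w0 wt => [_ wt _|b w w0 wt].
  suff -> : ts = [::] by exists Leaf.
  case: ts wt {tsN} => //= v ts [v1 _].
  by have [_ lt1 le1] := subinterval_ends v; rewrite v1 in lt1; exfalso; lra.
(* Here a nonempty address comes first and the empty one later. Later intervals start to the right
   of 0, whereas the empty address starts at 0. *)
rewrite /= => tsn; exfalso.
have gt0 x s : 0 < x -> tiling x s 1 -> all (fun w => w != [::]) s.
  elim: s x => [|v s IHs] x x0 //= [vx vt].
  have [_ lt01 _] := subinterval_ends v.
  rewrite (IHs _ _ vt) ?andbT; last by lra.
  by apply: contraL x0 => /eqP v0; rewrite -vx v0 ltxx.
move: tsn; rewrite (gt0 _ _ _ wt) //.
by have [_ + _] := subinterval_ends (b :: w); rewrite w0.
Qed.

End Words.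

(* Self-similarity: if [u] doubles the left half and [w] the right half of
   [[A, A + D]] while fixing the points outside on their side, then the
   commutator of [u] and [w] is a standard generator of the copy of F supported
   in that interval, and conjugation by [u^-1] and [w^-1] transports it to every
   standard dyadic subinterval. *)
Section Window.
Variable R : realType.
Variables (H : set (thompsonF R)) (A D : R) (u w : thompsonF R).
Hypothesis HH : is_subgroup H.
Hypotheses (D0 : 0 < D) (Hu : H u) (Hw : H w).
Hypothesis u_id : forall s : R, s <= A -> u s = s.
Hypothesis u_double : forall s : R, 0 <= s <= D / 2 -> u (A + s) = A + 2 * s.
Hypothesis w_id : forall s : R, A + D <= s -> w s = s.
Hypothesis w_double : forall s : R, 0 <= s <= D / 2 -> w (A + D - s) = A + D - 2 * s.
Implicit Types (f g h : thompsonF R) (x y : R) (b : bool) (v : seq bool).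

Let cell v x := A + D * subinterval v x.

(** In the coordinate of the window these act as the two maps [halve b]; inverses are taken because
    [u] and [w] expand. *)
Definition half_map b := (if b then w^-1 else u^-1)%g.

Lemma half_map_in b : H (half_map b).
Proof. by case: HH => _ _ HV; case: b; exact: HV. Qed.

Lemma half_mapE b x : 0 <= x <= 1 -> half_map b (A + D * x) = A + D * halve b x.
Proof.
move=> /andP[x0 x1]; have Dx : 0 <= D * x by rewrite mulr_ge0 // ltW.
have Dx1 : D * x <= D by rewrite ger_pMr.
rewrite /halve /half_map; case: b; apply: thompson_invE.
  have -> : A + D * ((x + 1) / 2) = A + D - (D - D * x) / 2 by field.
  by rewrite w_double; [field|lra].
by rewrite mulrA u_double; [field|lra].
Qed.

(** The copy of [g] in the half [b] of the window. *)
Definition bump b g := (half_map b * g * (half_map b)^-1)%g.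

Lemma bumpE b g x : 0 <= x <= 1 ->
  bump b g (A + D * halve b x) = half_map b (g (A + D * x)).
Proof. by move=> x01; rewrite -half_mapE // !thompson_mulE thompsonK. Qed.

Lemma bump_supported b g : supported A (A + D) g ->
  supported (A + D * halve b 0) (A + D * halve b 1) (bump b g).
Proof.
move=> /(@supported_conj _ _ _ _ (half_map b)).
have -> : A + D = A + D * 1 by rewrite mulr1.
by rewrite -{1}[A]addr0 -{1}[0](mulr0 D) !half_mapE; [|lra|lra].
Qed.

Lemma supported_cells b : A <= A + D * halve b 0 /\ A + D * halve b 1 <= A + D.
Proof.
by rewrite lerDl lerD2l ger_pMr // pmulr_rge0 //; rewrite /halve; case: b; lra.
Qed.

Definition local f : Prop := H f /\ supported A (A + D) f.

Lemma local1 : local 1%g.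
Proof. by case: HH => H1 _ _; split. Qed.

Lemma localM f g : local f -> local g -> local (f * g)%g.
Proof.
case: HH => _ HM _ [Hf fs] [Hg gs]; split; first exact: HM.
by move=> s sn; rewrite thompson_mulE gs ?fs.
Qed.

Lemma localV f : local f -> local (f^-1)%g.
Proof.
case: HH => _ _ HV [Hf fs]; split; first exact: HV.
by move=> s sn; apply: thompson_invE; exact: fs.
Qed.

Lemma local_bump b f : local f -> local (bump b f).
Proof.
have Hh := half_map_in b; case: HH => _ HM HV [Hf fs]; split.
  by apply: (HM); [exact: HM|exact: HV].
have [c1 c2] := supported_cells b.
exact: supported_sub c1 c2 (bump_supported fs).
Qed.

Fixpoint cells_map f (s t : seq (seq bool)) : Prop :=
  match s, t with
  | [::], [::] => True
  | v :: s', v' :: t' =>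
      (forall x, 0 <= x <= 1 -> f (cell v x) = cell v' x) /\ cells_map f s' t'
  | _, _ => False
  end.

Lemma cells_map_cat f s t s' t' :
  cells_map f s t -> cells_map f s' t' -> cells_map f (s ++ s') (t ++ t').
Proof. by elim: s t => [|v s IH] [|v' t] //= [vE /IH]; auto. Qed.

Lemma cells_map1 s : cells_map 1%g s s.
Proof. by elim: s. Qed.

Lemma cells_mapM f g r s t :
  cells_map f r s -> cells_map g s t -> cells_map (g * f)%g r t.
Proof.
elim: r s t => [|a r IH] [|b s] [|c t] //= [ab rs] [bc st].
by split; [move=> x x01; rewrite thompson_mulE ab ?bc|exact: IH st].
Qed.

Lemma cells_mapV f s t : cells_map f s t -> cells_map (f^-1)%g t s.
Proof.
elim: s t => [|a s IH] [|b t] //= [ab st].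
by split; [move=> x x01; apply: thompson_invE; exact: ab|exact: IH].
Qed.

Lemma cells_map_size f s t : cells_map f s t -> size s = size t.
Proof. by elim: s t => [|a s IH] [|b t] //= [_ /IH ->]. Qed.

Lemma cells_map_bump b f s t : cells_map f s t ->
  cells_map (bump b f) (map (cons b) s) (map (cons b) t).
Proof.
elim: s t => [|a s IH] [|c t] //= [ac st]; split; last exact: IH.
move=> x x01; rewrite /cell !subinterval_cons bumpE ?subinterval01 //.
by rewrite (ac x x01) half_mapE // subinterval01.
Qed.

Lemma cells_map_bump_id b f s : supported A (A + D) f ->
  cells_map (bump b f) (map (cons (~~ b)) s) (map (cons (~~ b)) s).
Proof.
move=> fs; elim: s => //= a s IH; split=> // x /(subinterval01 a) x01.
rewrite /cell subinterval_cons (bump_supported fs) //.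
rewrite !ltrD2l !ltr_pM2l //; apply/negP.
by rewrite /halve; case: (b) => /=; lra.
Qed.

Definition rotation := (w^-1 * u^-1 * w * u)%g.

(** Left of the window [u] is trivial and [w] maps the points among themselves; on the right the
    roles are exchanged. The commutator cancels on both sides. *)
Lemma rotation_local : local rotation.
Proof.
case: (HH) => _ HM HV; split; first by rewrite /rotation; do !apply: (HM) => //; exact: HV.
have D2 : 0 <= D / 2 <= D / 2 by rewrite lexx divr_ge0 // ltW.
have uV s : s <= A -> (u^-1)%g s = s by move=> sA; apply: thompson_invE; exact: u_id.
move=> s; rewrite negb_and -!leNgt /rotation !thompson_mulE => /orP[sA|sA].
  rewrite u_id // uV ?thompsonK //.
  apply: (@le_trans _ _ (w (A + D - D / 2))); last by rewrite w_double //; lra.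
  by rewrite thompson_le; lra.
have us : A + D <= u s.
  apply: (@le_trans _ _ (u (A + D / 2))); first by rewrite u_double //; lra.
  by rewrite thompson_le; lra.
by rewrite w_id // thompsonK; apply: thompson_invE; exact: w_id.
Qed.

(** On the first quarter only the doubling by [u] survives, because [w] pushes the left half out of
    the window, where [u] is trivial. The second quarter is spread by [u] and [w] over the whole
    window and then halved twice. The right half is pushed out by [u], where [w] is trivial, so only
    the halving by [w^-1] survives. *)
Lemma rotation_cells T1 T2 T3 : cells_map rotation
  (leaves (Node (Node T1 T2) T3)) (leaves (Node T1 (Node T2 T3))).
Proof.
have uV s : s <= A -> (u^-1)%g s = s by move=> sA; apply: thompson_invE; exact: u_id.
have E b : (if b then (w^-1)%g else (u^-1)%g) = half_map b by [].
rewrite /= !map_cat -catA -!map_comp.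
apply: cells_map_cat; last apply: cells_map_cat.
- elim: (leaves T1) => //= a s IH; split=> // x /(subinterval01 a) /andP[x0 x1].
  rewrite /cell !subinterval_cons; move: (subinterval a x) x0 x1 => {}x x0 x1.
  have Dx : 0 <= D * x by rewrite mulr_ge0 // ltW.
  have Dx1 : D * x <= D by rewrite ger_pMr.
  have uE : u (A + D * halve false (halve false x)) = A + D * (x / 2).
    have -> : D * halve false (halve false x) = D * x / 4 by rewrite /halve; field.
    by rewrite u_double; [field|lra].
  rewrite /rotation !thompson_mulE uE uV ?thompsonK //.
  apply: (@le_trans _ _ (w (A + D - D / 2))); last by rewrite w_double; lra.
  by rewrite thompson_le; lra.
- elim: (leaves T2) => //= a s IH; split=> // x /(subinterval01 a) /andP[x0 x1].
  rewrite /cell !subinterval_cons; move: (subinterval a x) x0 x1 => {}x x0 x1.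
  have Dx : 0 <= D * x by rewrite mulr_ge0 // ltW.
  have Dx1 : D * x <= D by rewrite ger_pMr.
  have uE : u (A + D * halve false (halve true x)) = A + D - D * (1 - x) / 2.
    have -> : D * halve false (halve true x) = D * (x + 1) / 4 by rewrite /halve; field.
    by rewrite u_double; [field|lra].
  rewrite /rotation !thompson_mulE uE w_double; last by lra.
  have -> : A + D - 2 * (D * (1 - x) / 2) = A + D * x by field.
  by rewrite (half_mapE false) ?x0 // (half_mapE true) // halve01 // x0.
- elim: (leaves T3) => //= a s IH; split=> // x /(subinterval01 a) /andP[x0 x1].
  rewrite /cell !subinterval_cons; move: (subinterval a x) x0 x1 => {}x x0 x1.
  have Dx : 0 <= D * x by rewrite mulr_ge0 // ltW.
  have Dp := D0.
  have sE : A + D * halve true x = A + (D * x + D) / 2 by rewrite /halve; field.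
  rewrite /rotation !thompson_mulE w_id.
    by rewrite thompsonK (half_mapE true) // halve01 // x0.
  apply: (@le_trans _ _ (u (A + D / 2))); first by rewrite u_double; lra.
  by rewrite thompson_le sE; lra.
Qed.

(** A rotation moves the first leaf of the left vine to the top; the remaining join takes place
    inside the right half, where a bumped element performs it. *)
Lemma cells_map_vine_join m n : exists2 f, local f &
  cells_map f (leaves (Node (rightvine m) (rightvine n))) (leaves (rightvine (m + n).+1)).
Proof.
elim: m => [|m [f lf fE]].
  by exists 1%g; [exact: local1|exact: cells_map1].
exists (bump true f * rotation)%g.
  by apply: localM; [exact: local_bump|exact: rotation_local].
apply: (cells_mapM (rotation_cells Leaf (rightvine m) (rightvine n))).
apply: cells_map_cat; first exact: (@cells_map_bump_id true f (leaves Leaf) lf.2).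
exact: cells_map_bump.
Qed.

Lemma cells_map_to_vine T : exists n f, local f /\ cells_map f (leaves T) (leaves (rightvine n)).
Proof.
elim: T => [|T1 [m [f [lf fE]]] T2 [n [g [lg gE]]]].
  by exists 0%N, 1%g; split; [exact: local1|exact: cells_map1].
have [h lh hE] := cells_map_vine_join m n.
exists (m + n).+1, (h * (bump true g * bump false f))%g; split.
  by apply: localM => //; apply: localM; exact: local_bump.
apply: cells_mapM hE; apply: cells_map_cat.
- apply: (cells_mapM (cells_map_bump false fE)).
  exact: (@cells_map_bump_id true g _ lg.2).
- apply: cells_mapM (cells_map_bump true gE).
  exact: (@cells_map_bump_id false f _ lf.2).
Qed.

Lemma cells_map_eq f g S t : supported A (A + D) f -> supported A (A + D) g ->
  cells_map f (leaves S) t -> cells_map g (leaves S) t -> f = g.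
Proof.
move=> fs gs fE gE; apply: thompsonF_eq => s.
have [sI|sn] := boolP (A < s < A + D); last by rewrite fs ?gs.
have [|v [y [vS y01 xE]]] := @leaves_cover R S ((s - A) / D).
  have Dp := D0; rewrite ler_pdivrMr // divr_ge0 //=; lra.
have -> : s = cell v y by rewrite /cell -xE mulrC divfK ?gt_eqF // addrC subrK.
elim: (leaves S) t vS fE gE => // a l IH [|b t] //=.
rewrite inE => /orP[/eqP <-|vl] [fa fE] [ga gE]; first by rewrite fa ?ga.
exact: IH fE gE.
Qed.

(** Both trees have the same number of leaves, hence are carried to the same vine; an element
    supported in the window is determined by its tree pair. *)
Lemma tree_pair_in f S T : supported A (A + D) f ->
  cells_map f (leaves S) (leaves T) -> H f.
Proof.
move=> fs fE; have [m [g [lg gE]]] := cells_map_to_vine S.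
have [n [h [lh hE]]] := cells_map_to_vine T.
have mn : m = n.
  apply: succn_inj; rewrite -!size_leaves_rightvine.
  by rewrite -(cells_map_size gE) -(cells_map_size hE) (cells_map_size fE).
rewrite {}mn in gE; have [Hk ks] : local (h^-1 * g)%g by apply: localM => //; exact: localV.
suff -> : f = (h^-1 * g)%g by [].
by apply: (cells_map_eq fs ks fE); exact: cells_mapM gE (cells_mapV hE).
Qed.

End Window.

(** * Tree pairs for elements supported in a window *)

Section TreePairs.
Variable R : realType.
Implicit Types (f g h : thompsonF R) (x y A D : R) (v w : seq bool).

Lemma subinterval_value w : exists i : nat,
  forall x : R, subinterval w x = (i%:R + x) / 2 ^+ size w.
Proof.
elim: w => [|b w [i iE]]; first by exists 0%N => x; rewrite add0r expr0 divr1.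
have n0 : (2 : R) ^+ size w != 0 by rewrite expf_neq0.
exists (if b then i + 2 ^ size w else i)%N => x; rewrite subinterval_cons iE /= exprS.
by case: b; rewrite /halve ?natrD ?natrX; field.
Qed.

Definition standard_on A D f v := exists v', forall x, 0 <= x <= 1 ->
  f (A + D * subinterval v x) = A + D * subinterval v' x.

Definition resolvable A D f v := exists T, forall l, l \in leaves T ->
  standard_on A D f (v ++ l).

Lemma resolvable_deep A D f N v :
  (forall w, size w = N -> resolvable A D f (v ++ w)) -> resolvable A D f v.
Proof.
elim: N v => [|N IH] v Nv; first by rewrite -[v]cats0; exact: Nv.
have rb b : resolvable A D f (rcons v b).
  by apply: IH => w wN; rewrite cat_rcons; apply: Nv; rewrite /= wN.
have [T1 T1P] := rb false; have [T2 T2P] := rb true.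
exists (Node T1 T2) => l; rewrite mem_cat => /orP[] /mapP[l' l'T ->].
- by rewrite -cat_rcons; exact: T1P.
- by rewrite -cat_rcons; exact: T2P.
Qed.

Lemma standard_cells A D f s : (forall v, v \in s -> standard_on A D f v) ->
  exists t, cells_map A D f s t.
Proof.
elim: s => [|v s IH] sP; first by exists [::].
have [v' v'E] := sP v (mem_head _ _).
have [|t tE] := IH; first by move=> w ws; apply: sP; rewrite inE ws orbT.
by exists (v' :: t).
Qed.

Lemma cells_map_tiling A D f s t x y x' y' : 0 < D ->
  tiling x s y -> cells_map A D f s t -> f (A + D * x) = A + D * x' ->
  f (A + D * y) = A + D * y' -> tiling x' t y'.
Proof.
move=> D0; have DI a b : A + D * a = A + D * b -> a = b :> R.
  by move=> /addrI/mulfI; apply; exact: lt0r_neq0.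
elim: s t x x' => [|v s IH] [|v' t] x x' //=.
  by move=> -> _ -> /DI.
move=> [<- st] [vE sE] fx fy; split; first by apply: DI; rewrite -fx -vE //; lra.
by apply: (IH _ _ _ st sE _ fy); rewrite vE //; lra.
Qed.

(** Under an affine map with slope a power of 2, the pieces of a subdivision have standard images
    once the image mesh is fine enough for the image of the left endpoint to lie on its grid. *)
Lemma affine_resolvable A D f v (m : int) : dyadic A -> (exists k : nat, D = 2 ^- k) ->
  0 <= A -> A + D <= 1 -> f A = A -> f (A + D) = A + D ->
  (forall x, 0 <= x <= 1 ->
     f (A + D * subinterval v x) = f (A + D * subinterval v 0) + D * 2 ^ m * x) ->
  resolvable A D f v.
Proof.
move=> dA [k DE] A0 AD fA fAD fE.
have D0 : 0 < D by rewrite DE invr_gt0 exprn_gt0.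
have [v0 v01 v1] := @subinterval_ends R v.
have Dv0 : 0 <= D * subinterval v 0 by rewrite mulr_ge0 // ltW.
have Dv1 : D * subinterval v 0 <= D by rewrite ger_pMr //; lra.
have [q [E qE]] : exists q E : nat,
    f (A + D * subinterval v 0) = A + D * (q%:R / 2 ^+ E).
  have dyd : dyadic ((f (A + D * subinterval v 0) - A) / D).
    apply: dyadicM; last by rewrite DE invrK -natrX; exact: dyadic_natr.
    apply: dyadicB => //; apply/thompson_dyadic; first lra.
    apply: dyadicD => //; apply: dyadicM; first by rewrite DE; exact: dyadicVX.
    have [i ->] := subinterval_value v; rewrite addr0.
    by apply: dyadicM; [exact: dyadic_natr|exact: dyadicVX].
  case: dyd => q [E qE].
  have q0 : 0 <= q.
    rewrite -(ler0z R) -(@pmulr_lge0 _ (2 ^- E)) ?invr_gt0 ?exprn_gt0 // -qE.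
    by apply: divr_ge0; rewrite ?(ltW D0) // subr_ge0 -{1}fA thompson_le; lra.
  exists `|q|%N, E; rewrite natr_absz ger0_norm // -qE [D * (_ / D)]mulrC divfK ?gt_eqF //.
  by rewrite [RHS]addrC subrK.
(* After [M1] halvings the images have relative length [2 ^- M]. The summand [|m|] ensures [E <= M],
   so that [q / 2 ^+ E] is on the grid. *)
pose M1 := (E + `|m|)%N; pose M := `|M1%:Z - m|%N.
apply: (@resolvable_deep _ _ _ M1) => w wM1.
have M1m : M%:Z = M1%:Z - m by rewrite /M /M1; lia.
have EM : (E <= M)%N by rewrite /M /M1; lia.
have [i iE] := subinterval_value w.
exists Leaf => l; rewrite inE => /eqP ->; rewrite cats0.
have wE x : 0 <= x <= 1 -> f (A + D * subinterval (v ++ w) x) =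
    A + D * (((q * 2 ^ (M - E) + i)%:R + x) / 2 ^+ M).
  move=> x01; rewrite subinterval_cat fE ?subinterval01 // qE iE wM1.
  rewrite -addrA -mulrA -mulrDr; congr (_ + _ * _).
  have -> : (2 : R) ^ m = 2 ^+ M1 / 2 ^+ M.
    by rewrite (_ : m = M1%:Z - M%:Z) ?expfzDr -?exprnN //; lia.
  rewrite natrD natrM natrX (_ : 2 ^+ M = 2 ^+ (M - E) * 2 ^+ E :> R).
    by field; rewrite !expf_neq0.
  by rewrite -exprD subnK.
have [|v' _ v'E] := @subinterval_nat R (q * 2 ^ (M - E) + i) M; last first.
  by exists v' => x x01; rewrite v'E wE.
have : f (A + D * subinterval (v ++ w) 1) <= A + D.
  rewrite -[leRHS]fAD thompson_le lerD2l ger_pMr //.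
  by have [] := @subinterval_ends R (v ++ w).
rewrite wE ?lexx ?ler01 // lerD2l ger_pMr // ler_pdivrMr ?exprn_gt0 // mul1r.
by rewrite -natrX natr1 ler_nat.
Qed.

Lemma seq_dyadic_grid (B : seq R) : (forall c, c \in B -> dyadic c) ->
  exists N : nat, forall c, c \in B -> exists m : int, c = m%:~R / 2 ^+ N.
Proof.
elim: B => [|c B IH] Bd; first by exists 0%N.
have [|N NE] := IH; first by move=> b bB; apply: Bd; rewrite inE bB orbT.
have lift (b : R) (m : int) n n' : (n <= n')%N -> b = m%:~R / 2 ^+ n ->
    exists m : int, b = m%:~R / 2 ^+ n'.
  move=> nn ->; exists (m * 2 ^+ (n' - n)); rewrite rmorphM rmorphXn /=.
  rewrite (_ : 2 ^+ n' = 2 ^+ (n' - n) * 2 ^+ n :> R); last by rewrite -exprD subnK.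
  by field; rewrite !expf_neq0.
have [m [n cE]] := Bd c (mem_head _ _).
exists (maxn n N) => b; rewrite inE => /orP[/eqP ->|/NE[p pE]].
- exact: lift (leq_maxl _ _) cE.
- exact: lift (leq_maxr _ _) pE.
Qed.

Lemma tree_pair_exists A D f : dyadic A -> (exists k : nat, D = 2 ^- k) ->
  0 <= A -> A + D <= 1 -> supported A (A + D) f ->
  exists S T, cells_map A D f (leaves S) (leaves T).
Proof.
move=> dA DE A0 AD fs; have [k Dk] := DE.
have D0 : 0 < D by rewrite Dk invr_gt0 exprn_gt0.
have fA : f A = A by apply: fs; rewrite ltxx.
have fAD : f (A + D) = A + D by apply: fs; rewrite ltxx andbF.
suff [S SP] : resolvable A D f [::].
  have [t tE] := standard_cells SP.
  have tt : tiling (0 : R) t 1.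
    apply: (cells_map_tiling D0 (tiling_leaves R S) tE); first by rewrite mulr0 addr0.
    by rewrite mulr1.
  by have [T TE] := tiling_tree tt; exists S, T; rewrite TE.
have [B [BI fB]] := thompson_pl f.
(* At depth [N] no breakpoint is interior to a standard interval of the window, so [f] is affine on
   each of them. *)
have [|N NE] := @seq_dyadic_grid [seq (c - A) / D | c <- B].
  move=> _ /mapP[c /BI[_ dc] ->]; apply: dyadicM; first exact: dyadicB.
  by rewrite Dk invrK -natrX; exact: dyadic_natr.
apply: (@resolvable_deep _ _ _ N) => w wN.
have [i iE] := subinterval_value w; have [w0 w01 w1] := @subinterval_ends R w.
have Dw0 : 0 <= D * subinterval w 0 by rewrite mulr_ge0 // ltW.
have Dw1 : D * subinterval w 1 <= D by rewrite ger_pMr.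
have Dw : D * subinterval w 0 < D * subinterval w 1 by rewrite ltr_pM2l.
have [||||l fl] := fB (A + D * subinterval w 0) (A + D * subinterval w 1); [lra|lra|lra| |].
  move=> c cB; have [|m mE] := NE ((c - A) / D); first exact: map_f.
  have -> : c = A + D * (m%:~R / 2 ^+ N).
    by rewrite -mE mulrC divfK ?gt_eqF // addrC subrK.
  rewrite !ltrD2l !ltr_pM2l // !iE wN !ltr_pM2r ?invr_gt0 ?exprn_gt0 //.
  rewrite addr0 natr1 -[i%:R]/(i%:Z%:~R) -[i.+1%:R]/(i.+1%:Z%:~R) !ltr_int.
  by apply/negP; lia.
apply: (@affine_resolvable _ _ _ _ (l - N%:Z)) => // x x01.
have xw : 0 <= subinterval w x - subinterval w 0 <= subinterval w 1 - subinterval w 0.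
  rewrite !iE -!mulrBl; have : 0 < (2 : R) ^- size w by rewrite invr_gt0 exprn_gt0.
  move=> p0; rewrite mulr_ge0 ?(ltW p0) ?ler_pM2r //=; lra.
rewrite cat0s (fl (A + D * subinterval w x)); last first.
  by rewrite !lerD2l !ler_pM2l //; lra.
rewrite expfzDr // -exprnN; congr (_ + _).
by rewrite !iE wN; field; rewrite expf_neq0.
Qed.

Lemma window_generates (H : set (thompsonF R)) A D (u w : thompsonF R) : is_subgroup H ->
  dyadic A -> (exists k : nat, D = 2 ^- k) -> 0 <= A -> A + D <= 1 ->
  H u -> H w -> (forall s, s <= A -> u s = s) ->
  (forall s, 0 <= s <= D / 2 -> u (A + s) = A + 2 * s) ->
  (forall s, A + D <= s -> w s = s) ->
  (forall s, 0 <= s <= D / 2 -> w (A + D - s) = A + D - 2 * s) ->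
  forall f, supported A (A + D) f -> H f.
Proof.
move=> HH dA DE A0 AD Hu Hw uid u2 wid w2 f fs.
have D0 : 0 < D by case: DE => k ->; rewrite invr_gt0 exprn_gt0.
have [S [T ST]] := tree_pair_exists dA DE A0 AD fs.
exact: (tree_pair_in HH D0 Hu Hw uid u2 wid w2 fs ST).
Qed.

End TreePairs.

(** * From a window to the kernel of the abelianization *)

Section Cover.
Variable R : realType.
Implicit Types (f g h : thompsonF R) (a b c d e s : R) (H : set (thompsonF R)).

(** Truncation: [f c < b] leaves room between [c] and [b] to return to the identity. *)
Lemma thompson_extend f b c : dyadic b -> dyadic c -> 0 < c -> c < b -> b < 1 ->
  f c < b -> exists g, (forall s, s <= c -> g s = f s) /\ (forall s, b <= s -> g s = s).
Proof.
move=> db dc c0 cb b1 fc.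
have dfc : dyadic (f c) by apply/thompson_dyadic => //; lra.
have [g1 g1P] := pl2_ext dc db dfc db cb fc.
have P1 := pl2_restrict f (lexx 0) c0 (ltW (lt_trans cb b1)).
have P3 := @pl2_id R b 1 b1.
have := pl2_glue dc P1 (pl2_glue db g1P P3).
rewrite thompson0 => /thompson_of_pl2[g gE].
exists g; split=> s sc.
- case: (leP 0 s) => s0; first by rewrite gE ?sc //; lra.
  by rewrite !thompson_out //; lra.
- case: (leP s 1) => s1; last by rewrite thompson_out //; lra.
  rewrite gE; last by lra.
  rewrite ifF; last by apply/negbTE; rewrite -ltNge; lra.
  case: ifP => // sb; have -> : s = b by [lra].
  by case: g1P => _ [_ ->].
Qed.

Lemma thompson_move c d s e : dyadic c -> dyadic d -> dyadic s -> dyadic e ->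
  0 < c -> c < s -> s < d -> c < e -> e < d -> d < 1 ->
  exists h, supported c d h /\ h s = e.
Proof.
move=> dc dd ds de c0 cs sd ce ed d1.
have [g1 g1P] := pl2_ext dc ds dc de cs ce.
have [g2 g2P] := pl2_ext ds dd de dd sd ed.
have := pl2_glue dc (pl2_id c0) (pl2_glue ds g1P (pl2_glue dd g2P (pl2_id d1))).
move=> /thompson_of_pl2[h hE]; exists h; split.
- move=> r rn; have [r01|rn01] := boolP (0 <= r <= 1); last first.
    by rewrite thompson_out //; apply: contra rn01; lra.
  rewrite hE //; case: leP => // cr; have dr : d <= r by move: rn; rewrite cr -leNgt.
  rewrite ifF; last by apply/negbTE; rewrite -ltNge; lra.
  case: ifP => // rd; have -> : r = d by lra.
  by case: g2P => _ [_ ->].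
- rewrite hE; last by lra.
  rewrite ifF; last by apply/negbTE; rewrite -ltNge; lra.
  by rewrite lexx; case: g1P => _ [_ ->].
Qed.

Definition contains_supported H a b := forall f, supported a b f -> H f.

(** If [f c < b], then [f] is a truncation [g] supported in [a, b] times [g^-1 * f], which is
    supported in [c, d]. Otherwise an element supported in [c, d] first moves [f c] below [b]. *)
Lemma contains_supported_overlap H a b c d : is_subgroup H ->
  dyadic b -> dyadic c -> dyadic d -> 0 < a -> a < c -> c < b -> b < d -> d < 1 ->
  contains_supported H a b -> contains_supported H c d -> contains_supported H a d.
Proof.
move=> [_ HM HV] db dc dd a0 ac cb bd d1 Hab Hcd.
have short f : supported a d f -> f c < b -> H f.
  move=> fs fc; have [|||g [gf gid]] := thompson_extend db dc _ _ _ fc; [lra|lra|lra|].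
  have -> : f = (g * (g^-1 * f))%g by rewrite mulVKg.
  apply: HM.
    apply: Hab => s sn; have [sa|bs] : s <= a \/ b <= s by move: sn; lra.
      by rewrite gf ?fs ?sn //; lra.
    exact: gid.
  apply: Hcd => s sn; rewrite thompson_mulE; have [sc|ds] : s <= c \/ d <= s by move: sn; lra.
    by rewrite -gf ?thompsonK.
  by rewrite fs; [apply: thompson_invE; rewrite gid //; lra|lra].
move=> f fs; case: (ltP (f c) b) => fc; first exact: short.
have fcd : f c < d by rewrite -(fs d) ?thompson_lt; lra.
have dfc : dyadic (f c) by apply/thompson_dyadic => //; lra.
have de : dyadic ((b + c) / 2).
  by apply: dyadicM; [exact: dyadicD|exact: (dyadicVX R 1)].
have [||||||h [hs hE]] := thompson_move dc dd dfc de; [lra|lra|lra|lra|lra|lra|].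
have -> : f = (h^-1 * (h * f))%g by rewrite mulKg.
apply: HM; first by apply: HV; exact: Hcd.
apply: short; last by rewrite thompson_mulE hE; lra.
move=> s sn; rewrite thompson_mulE fs // hs //; move: sn; lra.
Qed.

(** The translates of the window under H cover (0, 1), and overlapping ones merge. The supremum
    argument plays the part of compactness of [c, e]. *)
Lemma contains_supported_cover H a b : is_subgroup H -> dyadic a -> dyadic b ->
  0 < a -> b < 1 -> contains_supported H a b ->
  (forall s, 0 < s < 1 -> exists2 h, H h & a < h s < b) ->
  forall c e, 0 < c -> c < e -> e < 1 -> contains_supported H c e.
Proof.
move=> HH da db a0 b1 Hab orb c e c0 ce e1; have [_ HM HV] := HH.
pose P a' b' := [/\ 0 < a', b' < 1, dyadic a' /\ dyadic b' & contains_supported H a' b'].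
have ex s : 0 < s < 1 -> exists a' b', P a' b' /\ a' < s < b'.
  move=> s01; have [h Hh /andP[ahs hsb]] := orb s s01.
  exists ((h^-1)%g a), ((h^-1)%g b); split; last first.
    by rewrite -(thompson_lt h _ s) -(thompson_lt h s) !thompsonKV ahs.
  split; [by rewrite thompson_gt0|by rewrite thompson_lt1| |].
    by split; apply/thompson_dyadic => //; lra.
  move=> f fs; have -> : f = (h^-1 * (h * f * h^-1) * h)%g.
    by rewrite !mulgA mulVg mul1g -mulgA mulVg mulg1.
  apply: (HM) => //; apply: (HM); first exact: HV.
  by apply: Hab; have := @supported_conj R _ _ _ h fs; rewrite !thompsonKV.
have [|a1 [b1' [[a10 b11 [da1 db1] Hab1] cI]]] := ex c; first lra.
pose E := [set d | P a1 d].
have Eb1 : E b1' by split.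
have Esup : has_sup E by split; [exists b1'|exists 1 => d [_ /ltW]].
have S1 : b1' <= sup E by exact: sup_upper_bound.
case: (ltP e (sup E)) => eS; last first.
  have [|a2 [b2 [[a20 b21 [da2 db2] Hab2] SI]]] := ex (sup E); first lra.
  have [|d [_ d1 [_ dd] Had] ad] := @sup_adherent _ E (sup E - a2) _ Esup; first lra.
  have dS : d <= sup E by apply: sup_upper_bound => //; split.
  suff : b2 <= sup E by lra.
  apply: sup_upper_bound => //; split=> //.
  case: (leP a2 a1) => a12.
    by move=> f fs; apply: Hab2; apply: supported_sub fs => //; lra.
  by apply: (contains_supported_overlap HH dd da2 db2 a10 a12 _ _ b21 Had Hab2); lra.
have [|d [_ d1 _ Had] ed] := @sup_adherent _ E (sup E - e) _ Esup; first lra.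
by move=> f fs; apply: Had; apply: supported_sub fs; lra.
Qed.

Lemma thompson_pi_ker_supported f : thompson_pi f = 1%g ->
  exists c e, [/\ 0 < c, c < e, e < 1 & supported c e f].
Proof.
move=> f1; have [c c01 cE] := thompson_pi1P f; have [e e01 eE] := thompson_pi2P f.
have id1 s : s <= c -> f s = s.
  move=> sc; case: (leP 0 s) => s0; last by rewrite thompson_out //; lra.
  by rewrite cE ?s0 // f1 expr0z mul1r.
have id2 s : 1 - e <= s -> f s = s.
  move=> sc; case: (leP s 1) => s0; last by rewrite thompson_out //; lra.
  have -> : s = 1 - (1 - s) by ring.
  by rewrite eE ?f1 ?expr0z ?mul1r //; lra.
exists (c / 3), (1 - e / 3); split; [lra|lra|lra|].
by move=> s; rewrite negb_and -!leNgt => /orP[sc|es]; [apply: id1|apply: id2]; lra.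
Qed.

Lemma window_kernel H a D u w : is_subgroup H -> dyadic a ->
  (exists k : nat, D = 2 ^- k) -> 0 < a -> a + D < 1 ->
  H u -> H w -> (forall s, s <= a -> u s = s) ->
  (forall s, 0 <= s <= D / 2 -> u (a + s) = a + 2 * s) ->
  (forall s, a + D <= s -> w s = s) ->
  (forall s, 0 <= s <= D / 2 -> w (a + D - s) = a + D - 2 * s) ->
  (forall s, 0 < s < 1 -> exists2 h, H h & a < h s < a + D) ->
  forall f, thompson_pi f = 1%g -> H f.
Proof.
move=> HH da DE a0 aD Hu Hw uid u2 wid w2 orb f /thompson_pi_ker_supported.
move=> [c [e [c0 ce e1]]]; apply: (contains_supported_cover HH da _ a0 aD _ orb c0 ce e1).
  by case: DE => k ->; apply: dyadicD => //; exact: dyadicVX.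
exact: (window_generates HH da DE (ltW a0) (ltW aD) Hu Hw uid u2 wid w2).
Qed.

End Cover.

(** * Half-windows near an end *)

Section Dynamics.
Variable R : realType.
Implicit Types (f g h t u x : thompsonF R) (a b c d e s r v z : R).
Implicit Types (H : set (thompsonF R)).

(** A bounded increasing orbit would accumulate at a fixed point of [f] inside (a, b). The
    contradiction is drawn at the preimage [S'] of its supremum. *)
Lemma thompson_iter_reach f a b c s : f a = a -> f b = b ->
  (forall s, a < s < b -> s < f s) -> a < s < b -> c < b ->
  exists m : nat, c < (f ^+ m)%g s.
Proof.
move=> fa fb fgt sI cb; apply: contrapT => /forallNP nc.
have le_c m : (f ^+ m)%g s <= c by rewrite leNgt; apply/negP/nc.
pose E := [set (f ^+ m)%g s | m in setT].
have Es : E s by exists 0%N => //; rewrite expg0.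
have Esup : has_sup E by split; [exists s|exists c => _ [m _ <-]].
have sS : s <= sup E by exact: sup_upper_bound.
have Sc : sup E <= c by apply: ge_sup; [exists s|move=> _ [m _ <-]].
pose S' := (f^-1)%g (sup E).
have SS' : S' < sup E.
  by rewrite -(thompson_lt f) thompsonKV; apply: fgt; lra.
have [|_ [m _ <-] mS] := @sup_adherent _ E (sup E - S') _ Esup; first lra.
have : (f ^+ m.+1)%g s <= sup E by apply: sup_upper_bound => //; exists m.+1.
rewrite expgS thompson_mulE leNgt => /negP; apply.
by rewrite -[sup E](thompsonKV f) thompson_lt -/S'; lra.
Qed.

Lemma thompson_fundamental_domain H f a b c s : is_subgroup H -> H f ->
  f a = a -> f b = b -> (forall s, a < s < b -> s < f s) -> a < c < b -> a < s < b ->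
  exists2 h, H h & c <= h s < f c.
Proof.
move=> HH Hf fa fb fgt cI sI; have [_ _ HV] := HH; have [/andP[_ cb] /andP[_ sb]] := (cI, sI).
have [m0 m0P] := thompson_iter_reach fa fb fgt sI cb.
have exP : exists m, c <= (f ^+ m)%g s by exists m0; exact: ltW.
case: (ex_minnP exP) => -[|m] cm mmin; last first.
  exists (f ^+ m.+1)%g; first exact: is_subgroupX.
  rewrite cm expgS thompson_mulE thompson_lt ltNge; apply/negP => /mmin.
  by rewrite ltnn.
have [q0 q0P] := thompson_iter_reach fa fb fgt cI sb.
have exQ : exists m, s < (f ^+ m)%g c by exists q0.
move: cm; rewrite expg0 thompson_oneE => cs.
case: (ex_minnP exQ) => -[|q] sq qmin.
  by move: sq; rewrite expg0 thompson_oneE; lra.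
exists ((f ^+ q)^-1)%g; first by apply: HV; exact: is_subgroupX.
rewrite -(thompson_le (f ^+ q)%g) -(thompson_lt (f ^+ q)%g) thompsonKV.
rewrite -thompson_mulE -expgSr sq andbT leNgt; apply/negP => /qmin.
by rewrite ltnn.
Qed.

(* The second generator moves the points of (0, b) by small steps [z] towards
   its fixed point [b]; [2 ^ a] is the slope at 0 prescribed by the
   abelianization. *)
Definition end_shape (a : nat) z b (t : R -> R) : Prop :=
  [/\ if a is 0%N then
        (forall s, 0 <= s <= z -> t s = s) /\
        (forall s, z <= s <= 2 * z -> t s = 2 * s - z)
      else
        [/\ forall s, 0 <= s <= 2 * z / 2 ^+ a -> t s = 2 ^+ a * s,
            forall s, 0 <= s <= z / 2 ^+ a ->
              t (2 * z / 2 ^+ a + s) = 2 * z + 2 ^+ a / 2 * s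
          & forall s, 0 < s <= 2 * z -> s < t s],
      forall s, 2 * z <= s <= b - 2 * z -> t s = s + z
    & forall s, b - 2 * z <= s <= b -> t s = (s + b) / 2].

Lemma end_shape_fix (a : nat) z b t : 0 <= z -> end_shape a z b t -> t b = b.
Proof. by move=> z0 [_ _ ->]; [field|lra]. Qed.

Lemma end_shape_gt (a : nat) z b t s : 0 < z -> end_shape a z b t ->
  (if a is 0%N then z else 0) < s -> s < b -> s < t s.
Proof.
move=> z0 [tn tm tf] s0 sb; case: (leP s (2 * z)) => s2.
  case: a tn s0 => [[_ t0]|a [_ _ t0]] s0; last by apply: t0; rewrite s0.
  by rewrite t0 ?s2 ?andbT; lra.
case: (leP s (b - 2 * z)) => sb2; first by rewrite tm; lra.
by rewrite tf; lra.
Qed.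

Lemma end_shape_shift (a : nat) z b t (m : nat) s : 0 < z -> end_shape a z b t ->
  2 * z <= s -> s + m%:R * z <= b - z -> (t ^+ m)%g s = s + m%:R * z.
Proof.
move=> z0 [_ tm _] s2; elim: m => [|m IH] sm; first by rewrite expg0 mul0r addr0.
have mz : 0 <= m%:R * z by rewrite mulr_ge0 // ltW.
move: sm; rewrite -natr1 mulrDl mul1r => sm.
by rewrite expgS thompson_mulE IH ?tm; [ring|lra|lra].
Qed.

(* [window_end H b c d]: the left half of the hypotheses of [window_kernel] for
   the window [c, c + d], together with the fact that every point of (0, b) can
   be moved into it. *)
Definition window_end H b c d : Prop :=
  exists u, [/\ H u, forall s, s <= c -> u s = s,
    forall s, 0 <= s <= d / 2 -> u (c + s) = c + 2 * s
  & forall s, 0 < s < b -> exists2 h, H h & c < h s < c + d].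

(** For [a = 0] the second generator is trivial on [0, z]; only [x] can lift such points into its
    range. *)
Lemma doubling_reach x e z s : (forall s, 0 <= s <= e -> x s = 2 * s) ->
  2 * z <= e -> 0 < s <= z -> exists m : nat, z < (x ^+ m)%g s <= 2 * z.
Proof.
move=> xE ze /andP[s0 sz].
have [n nP] : exists n : nat, z < 2 ^+ n * s.
  have zs0 : 0 <= z / s by rewrite divr_ge0; lra.
  exists (Num.bound (z / s)); rewrite -ltr_pdivrMr //.
  by apply: (lt_trans (archi_boundP zs0)); rewrite -natrX ltr_nat ltn_expl.
elim: n s s0 sz nP => [|n IH] s s0 sz nP.
  by exists 0%N; rewrite expg0 thompson_oneE; lra.
have xs : x s = 2 * s by apply: xE; lra.
case: (ltP z (2 * s)) => s2; first by exists 1%N; rewrite expg1 xs; lra.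
have [|||m mP] := IH (2 * s); [lra|lra|by rewrite mulrA -exprSr|].
by exists m.+1; rewrite expgSr thompson_mulE xs.
Qed.

(** For [a = 0], conjugating [t] by the doubling [x] moves its break from [z] to [2 * z], where [t]
    is already a translation. For [a > 0], the powers [x ^+ a] and [t ^+ p] have the same slope at
    0, so [x ^+ a * t^-1 ^+ p] is trivial on [[0, 2 * z]]; just beyond, the slope of [t] has dropped
    by a factor 2, which leaves slope 2. *)
Lemma end_window_linear H (a p : nat) z b e t x : is_subgroup H -> H t -> H x ->
  0 < z -> 5 * z <= b -> end_shape a z b t -> (0 < p)%N -> (a = 0%N -> p = 1%N) ->
  3 * z <= e -> (forall s, 0 <= s <= e -> x s = 2 ^+ p * s) ->
  window_end H b (2 * z) z.
Proof.
move=> HH Ht Hx z0 zb tS p0 ap ze xE; have [H1 HM HV] := HH.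
have tb := end_shape_fix (ltW z0) tS.
have tgt := end_shape_gt z0 tS.
have t2 : t (2 * z) = 3 * z by case: tS => _ tm _; rewrite tm; [ring|lra].
(* [2 * z] is the only point of the fundamental domain [2z, 3z) outside the
   open window; [t] followed by [u^-1] moves it to the middle of the window. *)
have orb u : H u -> u (2 * z + z / 2) = 3 * z ->
    (forall s, 0 < s < b -> exists2 h, H h & 2 * z <= h s < 3 * z) ->
    forall s, 0 < s < b -> exists2 h, H h & 2 * z < h s < 2 * z + z.
  move=> Hu u3 dom s /dom[h Hh hs]; have [hE|hn] := eqVneq (h s) (2 * z).
    exists (u^-1 * t * h)%g; first by apply: (HM) => //; apply: (HM) => //; exact: HV.
    by rewrite !thompson_mulE hE t2 (thompson_invE u3); lra.
  by exists h => //; rewrite lt_neqAle eq_sym hn /=; lra.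
case: a ap tS tgt => [/(_ erefl) p1|a _] tS tgt; have [tn tm tf] := tS.
- case: tn => tid t2z; subst p; rewrite expr1 in xE.
  have xV s : 0 <= s <= 2 * e -> (x^-1)%g s = s / 2.
    by move=> s0; apply: thompson_invE; rewrite xE; [field|lra].
  have u1 s : s <= 2 * z -> (x * t * x^-1)%g s = s.
    move=> s2; rewrite !thompson_mulE; case: (leP 0 s) => s0; last first.
      by rewrite !thompson_out //; lra.
    by rewrite xV ?tid ?xE; [field|lra|lra|lra].
  have u2 s : 0 <= s <= z / 2 -> (x * t * x^-1)%g (2 * z + s) = 2 * z + 2 * s.
    by move=> s0; rewrite !thompson_mulE xV ?t2z ?xE; [field|lra|lra|lra].
  have Hu : H (x * t * x^-1)%g by apply: (HM); [exact: HM|exact: HV].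
  exists (x * t * x^-1)%g; split=> //; apply: (orb _ Hu).
    by rewrite u2; [field|lra].
  have tz : t z = z by apply: tid; lra.
  have dom s : z < s < b -> exists2 h, H h & 2 * z <= h s < 3 * z.
    move=> sI; rewrite -t2.
    apply: (thompson_fundamental_domain HH Ht tz tb) => //; last by lra.
    by move=> r /andP[]; exact: tgt.
  move=> s sI; case: (ltP z s) => sz; first by apply: dom; lra.
  have [||m mP] := @doubling_reach x e z s xE; [lra|lra|].
  have [|h Hh hP] := dom ((x ^+ m)%g s); first lra.
  by exists (h * x ^+ m)%g => //; apply: (HM) => //; exact: is_subgroupX.
- case: tn; have [q qE] : exists q : R, q = 2 ^+ a.+1 by exists (2 ^+ a.+1).
  rewrite -qE => t1 t12 _.
  have q2 : 2 <= q by rewrite qE exprS ler_peMr // exprn_ege1 // ler1n.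
  have tV1 s : 0 <= s <= 2 * z -> (t^-1)%g s = s / q.
    move=> /andP[s0 s2]; apply: thompson_invE.
    by rewrite t1 ?divr_ge0 ?ler_pM2r ?invr_gt0 //=; [field|..]; lra.
  have qX m : 1 <= q ^+ m by rewrite exprn_ege1 //; lra.
  have tVX m s : 0 <= s <= 2 * z -> ((t^-1) ^+ m)%g s = s / q ^+ m.
    move=> /andP[s0 s2]; elim: m => [|m IH]; first by rewrite expg0 expr0 divr1.
    rewrite expgS thompson_mulE IH tV1 ?exprSr ?invfM ?mulrA //.
    have qm := qX m; rewrite divr_ge0 ?ler_pdivrMr ?(le_trans s2) ?ler_peMr //; lra.
  have xX m s : 0 <= s -> 2 ^+ (p * m) * s <= e -> (x ^+ m)%g s = 2 ^+ (p * m) * s.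
    move=> s0; elim: m => [|m IH]; first by rewrite muln0 expg0 mul1r.
    rewrite mulnS exprD -mulrA => se.
    have le1 : 2 ^+ (p * m) * s <= e.
      by apply: le_trans se; rewrite ler_peMl ?exprn_ege1 ?mulr_ge0 ?exprn_ge0 ?ler1n.
    by rewrite expgS thompson_mulE IH // xE ?le1 // mulr_ge0 // exprn_ge0.
  have qpE : 2 ^+ (p * a.+1) = q ^+ p by rewrite qE -exprM mulnC.
  have xq s : 0 <= s <= 3 * z -> (x ^+ a.+1)%g (s / q ^+ p) = s.
    move=> /andP[s0 s3]; have qp := qX p.
    have qs : q ^+ p * (s / q ^+ p) = s by rewrite mulrC divfK // gt_eqF //; lra.
    by rewrite xX ?qpE ?qs // ?divr_ge0 //; lra.
  pose u := (x ^+ a.+1 * t^-1 ^+ p)%g.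
  have u1 s : s <= 2 * z -> u s = s.
    move=> s2; case: (leP 0 s) => s0; last by rewrite thompson_out //; lra.
    by rewrite thompson_mulE tVX ?s0 // xq //; lra.
  have u2 s : 0 <= s <= z / 2 -> u (2 * z + s) = 2 * z + 2 * s.
    move=> s0; rewrite thompson_mulE.
    rewrite (_ : t^-1 ^+ p = t^-1 ^+ p.-1 * t^-1)%g ?thompson_mulE; last first.
      by rewrite -expgSr prednK.
    have zq : 0 < z / q by rewrite divr_gt0 //; lra.
    have zq2 : z / q <= z / 2 by rewrite ler_pM2l // lef_pV2 ?posrE; lra.
    have sq : 0 <= s / q <= z / 2 / q by rewrite divr_ge0 ?ler_pM2r ?invr_gt0; lra.
    have -> : (t^-1)%g (2 * z + s) = (2 * z + 2 * s) / q.
      apply: thompson_invE; have -> : (2 * z + 2 * s) / q = 2 * z / q + 2 * (s / q) by ring.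
      by rewrite t12; [field|]; lra.
    have q0 : 0 < q by lra.
    have zq3 : 2 * z <= q * z by rewrite ler_pM2r.
    rewrite tVX; last by rewrite ler_pdivrMr // divr_ge0 //=; lra.
    by rewrite -mulrA -invfM -exprS prednK // xq //; lra.
  have Hu : H u by apply: (HM); apply: is_subgroupX => //; exact: HV.
  exists u; split=> //; apply: (orb _ Hu); first by rewrite u2; [field|lra].
  move=> s sI; rewrite -t2.
  apply: (thompson_fundamental_domain HH Ht (thompson0 t) tb) => //; last by lra.
  by move=> r /andP[]; exact: tgt.
Qed.

End Dynamics.

(** * The half-window of an element that is trivial near 0 *)

Section FlatEnd.
Variable R : realType.
Implicit Types (f g h t u v x : thompsonF R) (b c d e s r w z : R).
Implicit Types (H : set (thompsonF R)).

(* [k] fixes [c] and is linear up to [c + n], where its slope is halved, while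
   [v] has slope [2 ^ j] to the right of [c]; the commutator of [v] and [k] then
   has its first break at [c + n / 2 ^ j], with slope 2. *)
Lemma end_window_flat H (a j M i i' : nat) z b c e r w q t v g :
  is_subgroup H -> H t -> H v -> H g -> 0 < z -> end_shape a.+1 z b t ->
  2 * z <= c -> (0 < j)%N -> (0 < M)%N -> (0 < i)%N -> 0 < q ->
  (forall s, s <= c -> v s = s) ->
  (forall s, 0 <= s <= r -> v (c + s) = c + 2 ^+ j * s) ->
  (forall s, 0 <= s <= e -> g (b - s) = w - q * s) ->
  c + i%:R * z = b - 2 ^+ j * (M%:R * z) ->
  c + i'%:R * z = w - q * (2 ^+ j * (M%:R * z)) ->
  2 ^+ j * (M%:R * z) <= e -> q * (2 ^+ j * (M%:R * z)) <= r -> M%:R * z <= r ->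
  w - q * z / 2 <= b - z ->
  window_end H b (c + M%:R * z - z / 2 ^+ j) (z / 2 ^+ j).
Proof.
move=> HH Ht Hv Hg z0 tS c2z j0 M0 i0 q0 vid vE gE iE i'E le_e le_r le_r' wb.
have [H1 HM HV] := HH.
have Q2 : 2 <= (2 : R) ^+ j.
  by case: j j0 {vE iE i'E le_e le_r} => // j _; rewrite exprS ler_peMr // exprn_ege1 // ler1n.
have [N NE] : exists N : nat, N%:R * z = 2 ^+ j * (M%:R * z) - z.
  exists (2 ^ j * M).-1; rewrite mulrA -natrX -natrM -[in RHS](@prednK (2 ^ j * M)).
    by rewrite -natr1; ring.
  by rewrite muln_gt0 expn_gt0.
have iz : z <= i%:R * z by rewrite ler_peMl ?ler1n // ltW.
move: Q2 NE vE iE i'E le_e le_r; move: (2 ^+ j) => Q Q2 NE vE iE i'E le_e le_r.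
have Mz : z <= M%:R * z by rewrite ler_peMl ?ler1n // ltW.
have [m mE] : exists m, m = M%:R * z by exists (M%:R * z).
rewrite -!mE in Mz NE iE i'E le_e le_r le_r' *.
have [l lE] : exists l, l = Q * m by exists (Q * m).
rewrite -!lE in NE iE i'E le_e le_r.
have l2m : 2 * m <= l by rewrite lE ler_pM2r //; lra.
have [y yE] : exists y, y = z / Q by exists (z / Q).
rewrite -!yE.
have Q0 : 0 < Q by lra.
have Qy : Q * y = z by rewrite yE mulrC divfK // gt_eqF.
have y0 : 0 < y by rewrite yE divr_gt0.
have y2 : 2 * y <= z by rewrite -Qy ler_pM2r.
have qlt s s' : s <= s' -> q * s <= q * s' by move=> ?; rewrite ler_pM2l.
have tshift := end_shape_shift z0 tS.
(* [t ^+ i] brings [[c, c + l]] next to [b], [g] acts there with slope [q], and the inverse of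
   [t ^+ i'] brings the image back to [c]. On the last cell, of length [z], the final step of
   [t ^+ i] is the contraction at [b], which halves the slope. *)
pose k := ((t ^+ i')^-1 * g * t ^+ i)%g.
have tiV s : 2 * z <= s -> s + i'%:R * z <= b - z ->
    ((t ^+ i')^-1)%g (s + i'%:R * z) = s.
  by move=> s2 sb; apply: thompson_invE; rewrite tshift.
have qz0 : 0 < q * z by rewrite mulr_gt0.
have k1 s : 0 <= s <= l - z -> k (c + s) = c + q * s.
  move=> /andP[s0 s1]; have qs0 : 0 <= q * s by rewrite mulr_ge0 // ltW.
  have qs : q * z <= q * (l - s) by apply: qlt; lra.
  rewrite !thompson_mulE tshift; [|lra|lra].
  have -> : c + s + i%:R * z = b - (l - s) by lra.
  rewrite gE; last by lra.
  have -> : w - q * (l - s) = c + q * s + i'%:R * z by lra.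
  by rewrite tiV; lra.
have k2 s : 0 <= s <= z -> k (c + (l - z + s)) = c + q * (l - z) + q * s / 2.
  move=> /andP[s0 s1]; have qs0 : 0 <= q * s by rewrite mulr_ge0 // ltW.
  have qs : q * s <= q * z by apply: qlt.
  have qlz : 0 <= q * (l - z) by rewrite mulr_ge0 ?(ltW q0) //; lra.
  have i1 : i.-1%:R * z = i%:R * z - z by rewrite -[in RHS](prednK i0) -natr1; ring.
  rewrite !thompson_mulE -(prednK i0) expgS thompson_mulE tshift; [|lra|lra].
  have -> : c + (l - z + s) + i.-1%:R * z = b - 2 * z + s by lra.
  have [_ _ ->] := tS; last by lra.
  have -> : (b - 2 * z + s + b) / 2 = b - (z - s / 2) by field.
  rewrite gE; last by lra.
  have -> : w - q * (z - s / 2) = c + q * (l - z) + q * s / 2 + i'%:R * z by lra.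
  by rewrite tiV; lra.
have kc : k c = c by have := k1 0; rewrite mulr0 addr0; apply; lra.
(* Right of [c] both [v] and [k] are linear and commute, until [v] reaches the break of [k] at
   [c + l - z], that is, from [c + m - y] on. *)
pose u := (v^-1 * k^-1 * v * k)%g.
have uP s s' : v (k s) = k (v s') -> u s = s'.
  by move=> e1; rewrite /u !thompson_mulE e1 !thompsonK.
have Hk : H k by apply: (HM); [apply: (HM) => //; apply: HV|]; exact: is_subgroupX.
have Hu : H u.
  by apply: (HM) => //; apply: (HM) => //; apply: (HM); exact: HV.
have u1 s : s <= c + m - y -> u s = s.
  move=> sc; apply: uP; case: (leP s c) => sc'.
    by rewrite vid ?vid // -kc thompson_le.
  have -> : s = c + (s - c) by ring.
  have Qs : Q * (s - c) <= Q * (m - y) by rewrite ler_pM2l //; lra.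
  have Qs0 : 0 < Q * (s - c) by rewrite mulr_gt0 //; lra.
  have qs := qlt (s - c) l; have qs0 : 0 < q * (s - c) by rewrite mulr_gt0 //; lra.
  rewrite vE; last by lra.
  rewrite k1; last by lra.
  rewrite vE ?k1; [ring|lra|lra].
have u2 s : 0 <= s <= y / 2 -> u (c + m - y + s) = c + m - y + 2 * s.
  move=> /andP[s0 sy]; apply: uP.
  have -> : c + m - y + s = c + (m - y + s) by ring.
  have -> : c + m - y + 2 * s = c + (m - y + 2 * s) by ring.
  have qs := qlt (m - y + s) l; have qs0 : 0 <= q * (m - y + s) by rewrite mulr_ge0 // ?(ltW q0) //; lra.
  have Qs : Q * s <= Q * (y / 2) by rewrite ler_pM2l.
  have Qs0 : 0 <= Q * s by rewrite mulr_ge0 // ltW.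
  rewrite vE; last by lra.
  rewrite k1; last by lra.
  rewrite vE; last by lra.
  have -> : Q * (m - y + 2 * s) = l - z + 2 * (Q * s) by rewrite lE -Qy; ring.
  by rewrite k2 ?lE -?Qy; [field|lra].
exists u; split=> //.
have tb := end_shape_fix (ltW z0) tS; have tgt := end_shape_gt z0 tS.
have tc : t c = c + z by have := tshift 1%N c; rewrite expg1 mul1r; apply; lra.
have vy : v (c + y) = c + z by rewrite vE ?Qy; lra.
have cI : 0 < c < b by lra.
have dom s : 0 < s < b -> exists2 h, H h & c < h s < c + z.
  move=> sI; have [h Hh /andP[h1 h2]] := thompson_fundamental_domain HH Ht (thompson0 t) tb
    (fun s sI => tgt s (proj1 (andP sI)) (proj2 (andP sI))) cI sI.
  rewrite tc in h2.
  (* The endpoint [c] is not in the open interval; since [t c = c + z = v (c + y)], it is sent to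
     [c + y]. *)
  have [hE|hn] := eqVneq (h s) c.
    exists (v^-1 * t * h)%g; first by apply: (HM) => //; apply: (HM) => //; exact: HV.
    by rewrite !thompson_mulE hE tc (thompson_invE vy); lra.
  by exists h => //; rewrite lt_neqAle eq_sym hn h1 h2.
move=> s /dom[h Hh /andP[h1 h2]].
have h3 : 0 < (h s - c) / Q by rewrite divr_gt0 //; lra.
have h4 : (h s - c) / Q < y by rewrite yE ltr_pM2r ?invr_gt0 //; lra.
(* [t ^+ N] translates [(c, c + z)] to the last cell before [c + l], and [v^-1] shrinks that cell
   onto the window. *)
exists (v^-1 * (t ^+ N * h))%g.
  apply: (HM); first exact: HV.
  by apply: (HM) => //; exact: is_subgroupX.
have vw : v (c + ((h s - c) / Q + (m - y))) = h s + N%:R * z.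
  rewrite vE; last by lra.
  by rewrite NE lE -Qy; field; lra.
rewrite !thompson_mulE tshift; [|lra|lra].
by rewrite (thompson_invE vw); lra.
Qed.

End FlatEnd.

(** * Windows available for every sufficiently small step *)

Section EndWindow.
Variable R : realType.
Implicit Types (f g h t u v x : thompsonF R) (b c d e s r w z : R).
Implicit Types (H : set (thompsonF R)).

Lemma dyadic_or_linear f s : 0 < s < 1 -> dyadic s \/
  exists k e, 0 < e /\ forall r, - e <= r <= e -> f (s + r) = f s + 2 ^ k * r.
Proof.
move=> /andP[s0 s1]; have [B [Bd fB]] := thompson_pl f.
have [sB|snB] := boolP (s \in B); [by left; have [] := Bd s sB|right].
pose m : R := \big[Order.min/1]_(c <- B | s < c) c.
pose l : R := \big[Order.max/0]_(c <- B | c < s) c.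
have m1 : m <= 1 by exact: bigmin_le_id.
have ms : s < m.
  by rewrite /m; elim/big_ind : _ => // [u v u0 v0]; rewrite lt_min u0.
have l0 : 0 <= l by exact: bigmax_ge_id.
have ls : l < s.
  by rewrite /l; elim/big_ind : _ => // [u v u0 v0]; rewrite gt_max u0.
have [|c cB|k fk] := fB l m l0 _ m1; first exact: lt_trans ms.
  apply/negP => /andP[lc cm]; have [cs|sc|cs] := ltgtP c s.
  - by move: lc; rewrite ltNge le_bigmax_seq.
  - by move: cm; rewrite ltNge ge_bigmin_seq.
  - by rewrite -cs cB in snB.
have [e1 e2] : exists2 e, 0 < e & l <= s - e /\ s + e <= m.
  exists (Num.min (s - l) (m - s)); first by rewrite lt_min !subr_gt0 ls.
  by split; rewrite ?lerBrDr -?lerBrDl ?ge_min ?lexx ?orbT.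
move=> [le me]; exists k, e1; split=> // r re.
by rewrite (fk (s + r)) 1?(fk s); [ring|lra|lra].
Qed.

(** [c] is the supremum of the points up to which [x] is the identity. Its right slope is not 1 and
    its left slope is, so [c] is a breakpoint and hence dyadic. The inverse of [x] is taken when the
    slope is below 1. *)
Lemma first_break x s0 : (thompson_pi x).1 = 0 -> 0 < s0 <= 1 -> x s0 != s0 ->
  exists c v j r, [/\ v = x \/ v = (x^-1)%g, dyadic c /\ 0 < c < s0, 0 < r /\ (0 < j)%N,
    forall s, s <= c -> v s = s & forall s, 0 <= s <= r -> v (c + s) = c + 2 ^+ j * s].
Proof.
move=> x0 s01 xs0; have [e e0 xe] := thompson_pi1P x.
rewrite x0 expr0z in xe.
pose E := [set c | forall s, s <= c -> x s = s].
have Es0 c : E c -> c < s0 by rewrite ltNge => Ec; apply: contraNN xs0 => /Ec ->.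
have Ee : E e.
  move=> s se; case: (leP 0 s) => s0'; last by rewrite thompson_out //; lra.
  by rewrite xe ?mul1r // s0'.
have Esup : has_sup E by split; [exists e|exists s0 => c /Es0/ltW].
pose c := sup E.
have ec : e <= c by exact: sup_upper_bound.
have cs0 : c <= s0 by apply: ge_sup; [exists e|move=> d /Es0/ltW].
have ltc s : s < c -> x s = s.
  move=> sc; have [|d Ed sd] := @sup_adherent _ E (c - s) _ Esup; first by rewrite subr_gt0.
  by apply: Ed; rewrite -/c in sd; lra.
have xc : x c = c.
  apply/eqP; rewrite eq_le; apply/andP; split; rewrite leNgt; apply/negP => cc.
  - have /ltc : (x^-1)%g ((c + x c) / 2) < c.
      by rewrite -(thompson_lt x) thompsonKV; lra.
    rewrite thompsonKV => e1.
    have : (x^-1)%g ((c + x c) / 2) < c by rewrite -(thompson_lt x) thompsonKV; lra.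
    by rewrite -e1; lra.
  - by have := ltc _ cc => /thompson_inj e1; rewrite e1 ltxx in cc.
have lec s : s <= c -> x s = s.
  by rewrite le_eqVlt => /orP[/eqP ->|/ltc].
have cs : c < s0 by rewrite lt_neqAle cs0 andbT; apply: contraNneq xs0 => <-; rewrite xc.
have [|k [d [d0 dc xd]]] := @right_germ R x c; first lra.
rewrite xc in xd.
have k0 : k != 0.
  apply/eqP => k0; suff /(sup_upper_bound Esup) : E (c + d) by rewrite -/c; lra.
  move=> s sd; case: (leP s c) => sc; first exact: lec.
  have -> : s = c + (s - c) by ring.
  by rewrite xd ?k0 ?expr0z; lra.
have dyc : dyadic c.
  have [|//|[l [e1 [e10 xl]]]] := @dyadic_or_linear x c; first lra.
  have p2 : x (c - e1) = c - e1 by apply: lec; lra.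
  have p3 : c - e1 = c + 2 ^ l * (- e1) by rewrite -{1}p2 xl ?xc //; lra.
  have l1 : (2 : R) ^ l = 1.
    have : (2 ^ l - 1) * e1 = 0 by lra.
    by move=> /eqP; rewrite mulf_eq0 (gt_eqF e10) orbF subr_eq0 => /eqP.
  pose m := Num.min d e1.
  have m0 : 0 < m by rewrite lt_min d0.
  have [md me] : m <= d /\ m <= e1 by rewrite /m !ge_min !lexx orbT.
  have xm1 : x (c + m) = c + 2 ^ k * m by apply: xd; lra.
  have xm2 : x (c + m) = x c + 2 ^ l * m by apply: xl; lra.
  have : (2 ^ k - 1) * m = 0 by rewrite xm2 xc l1 in xm1; lra.
  move=> /eqP; rewrite mulf_eq0 (gt_eqF m0) orbF subr_eq0 => /eqP k1.
  by move: k0; rewrite (@exprz_inj2 R k 0) ?expr0z.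
case: k k0 xd => k k0 xd.
  exists c, x, k, d; split=> //; [by left|by split=> //; lra|by split=> //; rewrite lt0n].
exists c, (x^-1)%g, k.+1, (d / 2 ^+ k.+1); split; [by right|by split=> //; lra| | |].
- by split=> //; rewrite divr_gt0 ?exprn_gt0.
- by move=> s sc; apply: thompson_invE; exact: lec.
- move=> s /andP[s0' sd]; apply: thompson_invE.
  have p0 : 0 < (2 : R) ^+ k.+1 by rewrite exprn_gt0.
  rewrite xd.
    by rewrite NegzE -exprnN mulrA mulVf ?mul1r // gt_eqF.
  by rewrite mulr_ge0 ?(ltW p0) //= mulrC -ler_pdivlMr.
Qed.

(** Smallness conditions on the step are stated for all large [k], so that any finite number of them
    can be met together. *)
Lemma small_grid_near C e : 0 < e -> \forall k \near \oo, C * 2 ^- k <= e.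
Proof.
move=> e0; have [N NP] : exists N : nat, C <= e * N%:R.
  have := archi_boundP (normr_ge0 (C / e)); set N := Num.bound _ => NP.
  exists N; rewrite mulrC -ler_pdivrMr //.
  exact: le_trans (ler_norm _) (ltW NP).
near=> k; rewrite ler_pdivrMr ?exprn_gt0 //; apply: (le_trans NP).
rewrite ler_pM2l // -natrX ler_nat (@leq_trans k) ?(ltnW (ltn_expl _ _)) //.
by near: k; exact: nbhs_infty_ge.
Unshelve. all: end_near. Qed.

Lemma dyadic_grid_near s : dyadic s -> 0 < s ->
  \forall k \near \oo, exists i : nat, s = i%:R * 2 ^- k.
Proof.
move=> ds s0; have [m [N sE]] := dyadic_gt0P ds s0.
near=> k; have Nk : (N <= k)%N by near: k; exact: nbhs_infty_ge.
by exists (m.+1 * 2 ^ (k - N))%N; rewrite {1}(sE k).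
Unshelve. all: end_near. Qed.

(* Next to [b], an element [x] that is trivial near 0 must move [b] or fix
   it with slope 2: that is what makes [g] and [t] produce a break. *)
Definition end_transverse (a : nat) x b : Prop :=
  (thompson_pi x).1 != 0 /\ (a = 0%N -> `|(thompson_pi x).1 : int|%N = 1%N) \/
  [/\ (thompson_pi x).1 = 0, a != 0%N & exists2 g, g = x \/ g = (x^-1)%g &
    g b < b \/ exists2 e, 0 < e & forall s, 0 <= s <= e -> g (b - s) = b - 2 * s].

(** The window is chosen before [H] and [t], from [x] and the step alone. Its right end is on the
    grid of mesh [z], so that powers of [t] can bring the other half-window there. *)
Definition end_window_at (a : nat) x b z : Prop := exists c d,
  [/\ exists j : nat, d = 2 ^- j, dyadic c /\ 2 * z <= c, c + d <= b - 2 * z,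
      (exists i : nat, c + d = i%:R * z) /\ d <= z
    & forall H t, is_subgroup H -> H x -> H t -> end_shape a z b t -> window_end H b c d].

Lemma thompson_pi1_abs x : exists g, (g = x \/ g = (x^-1)%g) /\
  (thompson_pi g).1 = `|(thompson_pi x).1 : int|%N%:Z.
Proof.
pose p : int := (thompson_pi x).1; case: (leP 0 p) => p0.
  by exists x; split; [left|rewrite gez0_abs].
exists (x^-1)%g; split; first by right.
by rewrite thompson_piV -/p -[LHS]/(- p) ltz0_abs.
Qed.

Lemma end_window_at_linear (a : nat) x b : 0 < b -> (thompson_pi x).1 != 0 ->
  (a = 0%N -> `|(thompson_pi x).1 : int|%N = 1%N) ->
  \forall k \near \oo, end_window_at a x b (2 ^- k).
Proof.
move=> b0 x0 ax.
have [g [gx gE]] := thompson_pi1_abs x.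
have [e /andP[e0 _] ge] := thompson_pi1P g; rewrite gE in ge.
near=> k; have z0 : 0 < (2 : R) ^- k by rewrite invr_gt0 exprn_gt0.
have ze : 3 * 2 ^- k <= e by near: k; exact: small_grid_near.
have zb : 5 * 2 ^- k <= b by near: k; exact: small_grid_near.
exists (2 * 2 ^- k), (2 ^- k); split; [by exists k| |lra| |].
- by split=> //; apply: dyadicM; [exact: (dyadic_natr R 2)|exact: dyadicVX].
- by split=> //; exists 3%N; ring.
move=> H t HH Hx Ht tS.
have Hg : H g by have [_ _ HV] := HH; case: gx => ->; [|exact: HV].
apply: (end_window_linear HH Ht Hg z0 zb tS _ ax ze ge).
by rewrite absz_gt0.
Unshelve. all: end_near. Qed.

Lemma exists_nat_shift (k : int) : exists m n : nat, k + m%:Z = n%:Z.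
Proof. by exists (absz k), (absz (k + (absz k)%:Z)); lia. Qed.

Lemma end_window_at_flat (a : nat) x g b e : dyadic b -> 0 < b <= 1 ->
  (thompson_pi x).1 = 0 -> (g = x \/ g = (x^-1)%g) -> g b < b \/
  (0 < e /\ forall s, 0 <= s <= e -> g (b - s) = b - 2 * s) ->
  \forall k \near \oo, end_window_at a.+1 x b (2 ^- k).
Proof.
move=> db b01 x0 gx gb.
have [k [d [d0 gE kP]]] : exists k d, [/\ 0 < d,
    forall s, 0 <= s <= d -> g (b - s) = g b - 2 ^ k * s & g b < b \/ g b = b /\ k = 1].
  case: gb => [gb|[e0 gE]].
    have [k [d [d0 _ gE]]] := @left_germ R g b b01.
    by exists k, d; split=> //; left.
  have gbb : g b = b by have := gE 0; rewrite subr0 mulr0 subr0; apply; lra.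
  by exists 1, e; split=> // [s /gE ->|]; [rewrite gbb|right].
(* A moved point not beyond [b] forces the first break of [x] to lie to the left of [b]. *)
have [s0 [s00 s0b xs0]] : exists s0, [/\ 0 < s0, s0 <= b & x s0 != s0].
  have gs s : g s != s -> x s != s.
    by apply: contraNN => /eqP xs; case: gx => ->; [rewrite xs|rewrite -{1}xs thompsonK].
  case: kP => [gb'|[gbb k1]].
    by exists b; split=> //; [lra|apply: gs; rewrite lt_eqF].
  have [m0 [md mb]] : 0 < Num.min d (b / 2) /\ Num.min d (b / 2) <= d /\ Num.min d (b / 2) <= b / 2.
    by rewrite lt_min d0 !ge_min !lexx orbT; split=> //; lra.
  exists (b - Num.min d (b / 2)); split; [lra|lra|apply: gs].
  by rewrite gE ?gbb ?k1 ?expr1z; [rewrite lt_eqF //; lra|lra].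
have [|c [v [j [r [vx [dc cs0] [r0 j0] vid vE]]]]] := first_break x0 _ xs0; first lra.
have gc : g c = c.
  have xc : x c = c by case: vx (vid c (lexx c)) => -> // /(congr1 x); rewrite thompsonKV.
  by case: gx => ->; [exact: xc|exact: thompson_invE].
have w0 : c < g b by rewrite -{1}gc thompson_lt; lra.
have dw : dyadic (g b) by apply/thompson_dyadic => //; lra.
have [q qE] : exists q : R, q = 2 ^ k by exists (2 ^ k).
have q0 : 0 < q by rewrite qE exprz2_gt0.
(* [M] clears the denominator of [q * 2 ^+ j]: then the interval next to [b] and its image under [g]
   both have lengths that are multiples of the step. *)
have [M [L [M0 qL]]] : exists M L : nat, (0 < M)%N /\ q * (2 ^+ j * M%:R) = L%:R.
  have [m [n NE]] := exists_nat_shift (k + j%:Z).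
  exists (2 ^ m)%N, (2 ^ n)%N; split; first by rewrite expn_gt0.
  rewrite qE !natrX -[2 ^+ j]/(2 ^ j%:Z) -[2 ^+ m]/(2 ^ m%:Z).
  by rewrite -!expfzDr // addrA NE.
near=> n; have [z zE] : exists z : R, z = 2 ^- n by exists (2 ^- n).
have z0 : 0 < z by rewrite zE invr_gt0 exprn_gt0.
have [ic icE] : exists i : nat, c = i%:R * z.
  by rewrite zE; near: n; apply: dyadic_grid_near => //; lra.
have [ib ibE] : exists i : nat, b = i%:R * z.
  by rewrite zE; near: n; apply: dyadic_grid_near => //; lra.
have [iw iwE] : exists i : nat, g b = i%:R * z.
  by rewrite zE; near: n; apply: dyadic_grid_near => //; lra.
have n1 : 2 * z <= c by rewrite zE; near: n; apply: small_grid_near; lra.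
have n2 : (2 ^+ j * M%:R + 1) * z <= b - c.
  by rewrite zE; near: n; apply: small_grid_near; lra.
have n3 : L%:R * z <= g b - c by rewrite zE; near: n; apply: small_grid_near; lra.
have n4 : 2 ^+ j * M%:R * z <= d by rewrite zE; near: n; exact: small_grid_near.
have n5 : L%:R * z <= r by rewrite zE; near: n; exact: small_grid_near.
have n6 : M%:R * z <= r by rewrite zE; near: n; exact: small_grid_near.
have ltz (p p' : nat) : p%:R * z <= p'%:R * z -> (p <= p')%N.
  by rewrite ler_pM2r // ler_nat.
have [i [i0 iE]] : exists i : nat, (0 < i)%N /\ c + i%:R * z = b - 2 ^+ j * (M%:R * z).
  have m2 : (2 ^ j * M + ic < ib)%N.
    apply: ltz; rewrite -natr1 natrD natrM natrX; move: n2; rewrite ibE icE.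
    by clear; move=> n2; lra.
  exists (ib - (2 ^ j * M + ic))%N; rewrite subn_gt0 m2; split=> //.
  rewrite natrB ?(ltnW m2) // natrD natrM natrX; move: ibE icE.
  by clear; move=> -> ->; ring.
have [i' i'E] : exists i : nat, c + i%:R * z = g b - q * (2 ^+ j * (M%:R * z)).
  have m3 : (L + ic <= iw)%N.
    by apply: ltz; rewrite natrD; move: n3; rewrite iwE icE; clear; move=> n3; lra.
  exists (iw - (L + ic))%N; rewrite natrB // natrD -qL; move: iwE icE.
  by clear; move=> -> ->; ring.
have j2 : (M.+1 <= 2 ^ j * M)%N.
  by rewrite ltn_Pmull // (leq_ltn_trans j0) // ltn_expl.
have zj : z / 2 ^+ j <= z by rewrite ler_pdivrMr ?exprn_gt0 // ler_peMr ?exprn_ege1 ?ler1n ?ltW.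
have zM : z <= M%:R * z by rewrite ler_peMl ?ler1n // ltW.
rewrite -zE; exists (c + M%:R * z - z / 2 ^+ j), (z / 2 ^+ j); split.
- by exists (n + j)%N; rewrite zE exprD invfM.
- split; last by move: n1 zM zj; clear; move=> ? ? ?; lra.
  rewrite zE; apply: dyadicB; last by apply: dyadicM; exact: dyadicVX.
  by apply: dyadicD => //; apply: dyadicM; [exact: dyadic_natr|exact: dyadicVX].
- have : M.+1%:R * z <= (2 ^ j * M)%N%:R * z by rewrite ler_pM2r ?ler_nat.
  by rewrite -natr1 natrM natrX; move: n2 zj; clear; move=> ? ? ?; lra.
- by split=> //; exists (ic + M)%N; rewrite subrK icE natrD; ring.
move=> H t HH Hx Ht tS; have [_ _ HV] := HH.
have Hg : H g by case: gx => ->; [|exact: HV].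
have Hv : H v by case: vx => ->; [|exact: HV].
apply: (@end_window_flat R H a j M i i' z b c d r (g b) q t v g) => //.
- by move=> s /gE ->; rewrite qE.
- by rewrite mulrA.
- by rewrite [2 ^+ j * _]mulrA mulrA qL.
(* If [g b < b], these are distinct grid points and differ by at least [z]. Otherwise the slope is 2
   and equality holds. *)
- case: (kP) => [gb'|[gbb k1]]; last by rewrite gbb qE k1 expr1z; clear; lra.
  have : (iw < ib)%N by rewrite -(ltr_nat R) -(ltr_pM2r z0) -iwE -ibE.
  rewrite -(ler_nat R) -(ler_pM2r z0) -natr1 mulrDl -iwE -ibE => iz.
  have : 0 < q * z by rewrite mulr_gt0.
  by move: iz; clear; move=> ? ?; lra.
Unshelve. all: end_near. Qed.

Lemma end_window_at_near (a : nat) x b : dyadic b -> 0 < b <= 1 ->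
  end_transverse a x b -> \forall k \near \oo, end_window_at a x b (2 ^- k).
Proof.
move=> db b01 [[x0 ax]|[x0 a0 [g gx gb]]].
  by apply: end_window_at_linear => //; lra.
case: a a0 => // a _; case: gb => [gb|[e e0 gE]].
  by apply: (@end_window_at_flat a x g b 1) => //; left.
by apply: (@end_window_at_flat a x g b e) => //; right.
Qed.

End EndWindow.

(** * Existence of the second generator *)

Section Existence.
Variable R : realType.
Implicit Types (f g h t u v x : thompsonF R) (a b c d e s r w z : R).

Lemma pl2_slope a b c d (k : int) : a < b -> d = c + 2 ^ k * (b - a) ->
  pl2 (fun s => c + 2 ^ k * (s - a)) a b c d.
Proof. by move=> ab ->; exact: pl2_affine. Qed.

Lemma thompson_of_pl2_left (f : R -> R) b : dyadic b -> b <= 1 -> pl2 f 0 b 0 b ->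
  exists g, forall s, 0 <= s <= b -> g s = f s.
Proof.
move=> db; rewrite le_eqVlt => /orP[/eqP -> |b1] fP; first exact: thompson_of_pl2.
have [g gE] := thompson_of_pl2 (pl2_glue db fP (pl2_id b1)).
by exists g => s sI; rewrite gE ?ifT //; lra.
Qed.

Lemma end_tail_exists (f : R -> R) z b : dyadic z -> 0 < z -> dyadic b -> 5 * z <= b -> b <= 1 ->
  pl2 f 0 (2 * z) 0 (3 * z) -> exists t : thompsonF R,
  [/\ forall s, 0 <= s <= 2 * z -> t s = f s,
      forall s, 2 * z <= s <= b - 2 * z -> t s = s + z
    & forall s, b - 2 * z <= s <= b -> t s = (s + b) / 2].
Proof.
move=> dz z0 db zb b1 fP.
have d2z : dyadic (2 * z) by apply: dyadicM => //; exact: (dyadic_natr R 2).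
have P2 : pl2 (fun x : R => 3 * z + 2 ^ (0 : int) * (x - 2 * z)) (2 * z) (b - 2 * z) (3 * z) (b - z).
  by apply: pl2_slope; [lra|rewrite expr0z; ring].
have P3 : pl2 (fun x : R => b - z + 2 ^ (-1 : int) * (x - (b - 2 * z))) (b - 2 * z) b (b - z) b.
  by apply: pl2_slope; [lra|rewrite exprN1; field].
have db2 : dyadic (b - 2 * z) by exact: dyadicB.
have [t tE] := thompson_of_pl2_left db b1 (pl2_glue d2z fP (pl2_glue db2 P2 P3)).
have [_ [_ f2] _ _ _] := fP.
exists t; split=> s sI; rewrite tE; try lra.
- by rewrite ifT //; lra.
- case: ifP => s2; first by have -> : s = 2 * z by [lra]; rewrite f2; ring.
  by rewrite ifT ?expr0z; [ring|lra].
- rewrite ifF; last by apply/negbTE; rewrite -ltNge; lra.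
  by case: ifP => s2; rewrite ?expr0z ?exprN1; [lra|field].
Qed.

Lemma end_shape_exists (a : nat) z b : dyadic z -> 0 < z -> dyadic b ->
  5 * z <= b -> b <= 1 -> exists t : thompsonF R, end_shape a z b t.
Proof.
move=> dz z0 db zb b1; case: a => [|a].
  have P2 : pl2 (fun x : R => z + 2 ^ (1 : int) * (x - z)) z (2 * z) z (3 * z).
    by apply: pl2_slope; [lra|rewrite expr1z; ring].
  have [t [t1 t2 t3]] := end_tail_exists dz z0 db zb b1 (pl2_glue dz (pl2_id z0) P2).
  exists t; split=> //; split=> s sI; rewrite t1; try lra.
    by rewrite ifT //; lra.
  by case: ifP => sz; rewrite ?expr1z; [lra|ring].
have [q qE] : exists q : R, q = 2 ^+ a.+1 by exists (2 ^+ a.+1).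
have q2 : 2 <= q by rewrite qE exprS ler_peMr // exprn_ege1 // ler1n.
have q0 : 0 < q by lra.
have zq : 0 < z / q by rewrite divr_gt0.
have qz : q * (z / q) = z by rewrite mulrC divfK // gt_eqF.
have zq2 : 2 * (z / q) <= z by rewrite -[leRHS]qz ler_pM2r.
have dn (n : nat) : dyadic (n%:R * (z / q)).
  apply: dyadicM; first exact: dyadic_natr.
  by apply: dyadicM => //; rewrite qE; exact: dyadicVX.
have P1 : pl2 (fun x : R => 0 + 2 ^ a.+1%:Z * (x - 0)) 0 (2 * (z / q)) 0 (2 * z).
  by apply: pl2_slope; [lra|rewrite -[2 ^ _]/(2 ^+ a.+1) -qE subr0 add0r mulrCA qz].
have qa : q / 2 = 2 ^ a%:Z by rewrite qE exprS mulrC mulKf.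
have P2 : pl2 (fun x : R => 2 * z + 2 ^ a%:Z * (x - 2 * (z / q))) (2 * (z / q)) (3 * (z / q))
    (2 * z) (2 * z + z / 2).
  by apply: pl2_slope; [lra|rewrite -qa -[in LHS]qz; field; lra].
(* Between [3 * z / q] and [2 * z] it is only required that points move to the right; the values
   there are at least [2 * z + z / 2], so any extension will do. *)
have [f fP] : exists f : R -> R, pl2 f (3 * (z / q)) (2 * z) (2 * z + z / 2) (3 * z).
  have d2z : dyadic (2 * z) by apply: dyadicM => //; exact: (dyadic_natr R 2).
  have d3z : dyadic (3 * z) by apply: dyadicM => //; exact: (dyadic_natr R 3).
  have d52 : dyadic (2 * z + z / 2).
    by apply: dyadicD => //; apply: dyadicM => //; exact: (dyadicVX R 1).
  by apply: (pl2_ext (dn 3%N) d2z d52 d3z); lra.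
have [t [t1 t2 t3]] := end_tail_exists dz z0 db zb b1
  (pl2_glue (dn 2%N) P1 (pl2_glue (dn 3%N) P2 fP)).
have tn1 s : 0 <= s <= 2 * (z / q) -> t s = q * s.
  by move=> sI; rewrite t1 ?ifT; [rewrite subr0 add0r qE|lra|lra].
have tn2 s : 0 <= s <= z / q -> t (2 * (z / q) + s) = 2 * z + q / 2 * s.
  move=> /andP[s0 sz]; rewrite t1; last lra.
  case: ifP => s2; first have s00 : s = 0 by lra.
    by rewrite s00 !mulr0 !addr0 add0r subr0 -[2 ^ _]/(2 ^+ a.+1) -qE mulrCA qz.
  by rewrite ifT; [rewrite qa; ring|lra].
exists t; split=> //; rewrite -qE -!mulrA; split=> //.
move=> s /andP[s0 s2]; case: (leP s (2 * (z / q))) => sq.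
  rewrite tn1; last by rewrite sq ltW.
  by rewrite ltr_pMl //; lra.
case: (leP s (3 * (z / q))) => sq3.
  have ts : t (2 * (z / q)) < t s by rewrite thompson_lt.
  have t2z : t (2 * (z / q)) = 2 * z.
    rewrite tn1; first by rewrite mulrCA qz.
    by rewrite lexx mulr_ge0 // ltW.
  by rewrite t2z in ts; move: ts zq2 sq3 zq; clear; move=> *; lra.
have ts : t (3 * (z / q)) < t s by rewrite thompson_lt.
have t3z : t (3 * (z / q)) = 2 * z + z / 2.
  have -> : 3 * (z / q) = 2 * (z / q) + z / q by ring.
  rewrite tn2; last by rewrite lexx ltW.
  by congr (_ + _); rewrite -[in RHS]qz; ring.
by rewrite t3z in ts; move: ts s2 z0; clear; move=> *; lra.
Qed.

Lemma end_shape_pi (a : nat) z b t : 0 < z -> end_shape a z b t ->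
  (thompson_pi t).1 = a%:Z.
Proof.
move=> z0; case: a => [|a] [tn _ _].
  by case: tn => tn _; apply: (thompson_pi1_germ z0) => s /tn ->; rewrite expr0z mul1r.
case: tn => tn _ _; apply: (@thompson_pi1_germ _ _ _ (2 * z / 2 ^+ a.+1)) => //.
by rewrite divr_gt0 ?exprn_gt0 // mulr_gt0.
Qed.

Lemma end_shape_ext (a : nat) z b t t' : 0 < z -> 5 * z <= b ->
  (forall s, 0 <= s <= b -> t' s = t s) -> end_shape a z b t -> end_shape a z b t'.
Proof.
move=> z0 zb tt [tn tm tf]; split; last 2 first.
- by move=> s sI; rewrite tt ?tm //; lra.
- by move=> s sI; rewrite tt ?tf //; lra.
case: a tn => [|a] [tn1 tn2].
  by split=> s sI; rewrite tt; [exact: tn1|lra|exact: tn2|lra].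
have q1 : 1 <= (2 : R) ^+ a.+1 by rewrite exprn_ege1 // ler1n.
have zq : 0 < z / 2 ^+ a.+1 by rewrite divr_gt0 //; lra.
have zq1 : z / 2 ^+ a.+1 <= z by rewrite ler_pdivrMr ?ler_peMr //; lra.
move=> tn3; split=> s sI.
- by rewrite tt ?tn1 //; move: sI; rewrite -mulrA => sI; lra.
- by rewrite tt ?tn2 //; rewrite -mulrA; lra.
- by rewrite tt ?tn3 //; lra.
Qed.

Lemma thompson_pi1_ext f g e : 0 < e -> (forall s, 0 <= s <= e -> f s = g s) ->
  (thompson_pi f).1 = (thompson_pi g).1.
Proof.
move=> e0 fg; have [d /andP[d0 _] gE] := thompson_pi1P g.
apply: (@thompson_pi1_germ _ _ _ (Num.min e d)); first by rewrite lt_min e0.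
by move=> s; rewrite le_min => /and3P[s0 se sd]; rewrite fg ?gE ?s0.
Qed.

(** The halving at 1 mirrors the doubling at 0, so the inverse read from the other end has the same
    shape. *)
Lemma translation_exists z : dyadic z -> 0 < z -> 5 * z <= 1 -> exists t : thompsonF R,
  [/\ end_shape 1 z 1 t, end_shape 1 z 1 (flip t^-1)%g & thompson_pi t = (1 : int, -1 : int)].
Proof.
move=> dz z0 z1.
have P1 : pl2 (fun x : R => 0 + 2 ^ (1 : int) * (x - 0)) 0 z 0 (2 * z).
  by apply: pl2_slope => //; rewrite expr1z; ring.
have P2 : pl2 (fun x : R => 2 * z + 2 ^ (0 : int) * (x - z)) z (2 * z) (2 * z) (3 * z).
  by apply: pl2_slope; [lra|rewrite expr0z; ring].
have [t [t1 t2 t3]] := end_tail_exists dz z0 (dyadic1 R) z1 (lexx 1) (pl2_glue dz P1 P2).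
have ta s : 0 <= s <= z -> t s = 2 * s.
  by move=> sI; rewrite t1 ?ifT ?expr1z; [ring|lra|lra].
have tb s : z <= s <= 1 - 2 * z -> t s = s + z.
  move=> sI; case: (leP s (2 * z)) => s2; last by apply: t2; lra.
  by rewrite t1; [case: ifP => sz; rewrite ?expr1z ?expr0z; lra|lra].
have shape (f : thompsonF R) : (forall s, 0 <= s <= z -> f s = 2 * s) ->
    (forall s, z <= s <= 1 - 2 * z -> f s = s + z) ->
    (forall s, 1 - 2 * z <= s <= 1 -> f s = (s + 1) / 2) -> end_shape 1 z 1 f.
  move=> f1 f2 f3; split=> //; last by move=> s sI; apply: f2; lra.
  rewrite expr1; split=> s sI.
  - by apply: f1; lra.
  - by rewrite f2; [field|lra].
  - by case: (leP s z) => sz; [rewrite f1|rewrite f2]; lra.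
exists t; split; first exact: shape.
- apply: shape => s sI; rewrite flipE.
  + have -> : (t^-1)%g (1 - s) = 1 - 2 * s by apply: thompson_invE; rewrite t3; [field|lra].
    by ring.
  + have -> : (t^-1)%g (1 - s) = 1 - s - z by apply: thompson_invE; rewrite tb; [ring|lra].
    by ring.
  + have -> : (t^-1)%g (1 - s) = (1 - s) / 2 by apply: thompson_invE; rewrite ta; [field|lra].
    by field.
rewrite [LHS]surjective_pairing; congr pair.
- by apply: (thompson_pi1_germ z0) => s /ta ->; rewrite expr1z.
- by apply: (thompson_pi2_germ z0) => s sI; rewrite t3 ?exprN1; [field|lra].
Qed.

Lemma thompson_pi_surj (a b : int) : exists f : thompsonF R, thompson_pi f = (a, b).
Proof.
have [z [dz z0 za zb]] : exists z : R, [/\ dyadic z, 0 < z, 3 * z <= 1 &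
    3 * (2 ^ a * z) <= 1 /\ 3 * (2 ^ b * z) <= 1].
  near \oo => k; exists (2 ^- k); rewrite !mulrA; split.
  - exact: dyadicVX.
  - by rewrite invr_gt0 exprn_gt0.
  - by near: k; exact: small_grid_near.
  - by split; near: k; exact: small_grid_near.
have a0 : 0 < 2 ^ a * z by rewrite mulr_gt0 ?exprz2_gt0.
have b0 : 0 < 2 ^ b * z by rewrite mulr_gt0 ?exprz2_gt0.
have daz : dyadic (2 ^ a * z) by apply: dyadicM => //; exact: dyadicXz.
have dbz : dyadic (1 - 2 ^ b * z).
  by apply: dyadicB; [exact: dyadic1|apply: dyadicM => //; exact: dyadicXz].
have d1z : dyadic (1 - z) by apply: dyadicB => //; exact: dyadic1.
have [f fP] : exists f : R -> R, pl2 f z (1 - z) (2 ^ a * z) (1 - 2 ^ b * z).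
  by apply: pl2_ext => //; lra.
have P1 := @pl2_affine R 0 z 0 a z0.
rewrite add0r subr0 in P1.
have P3 : pl2 (fun x : R => 1 - 2 ^ b * z + 2 ^ b * (x - (1 - z))) (1 - z) 1 (1 - 2 ^ b * z) 1.
  by apply: pl2_slope; [lra|ring].
have [g gE] := thompson_of_pl2 (pl2_glue dz P1 (pl2_glue d1z fP P3)).
exists g; rewrite [LHS]surjective_pairing; congr pair.
- by apply: (thompson_pi1_germ z0) => s sI; rewrite gE ?ifT; [ring|lra|lra].
- have z2 : 0 < z / 2 by lra.
  apply: (thompson_pi2_germ z2) => s sI; rewrite gE; last lra.
  rewrite ifF; last by apply/negbTE; rewrite -ltNge; lra.
  by rewrite ifF; [ring|apply/negbTE; rewrite -ltNge; lra].
Unshelve. all: end_near. Qed.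

End Existence.

(** * Matching the two half-windows *)

Section Matching.
Variable R : realType.
Implicit Types (f g h t u v w x y : thompsonF R) (a b c d e q r s z : R).
Implicit Types (H : set (thompsonF R)).

Definition contains_kernel H := forall f, thompson_pi f = 1%g -> H f.

(* [w] gives the right half of a window at [e] instead of [c + d]; conjugating
   it by [h], which is linear to the left of [e], brings it to [c + d]. *)
Lemma window_match H b c d e r q w h : is_subgroup H -> dyadic c ->
  (exists j : nat, d = 2 ^- j) -> 0 < c -> c + d < 1 -> window_end H b c d ->
  H w -> H h -> 0 < q -> d / 2 <= q * r ->
  (forall s, e <= s -> w s = s) ->
  (forall s, 0 <= s <= r -> w (e - s) = e - 2 * s) ->
  (forall s, 0 <= s -> q * s <= d -> h (e - s) = c + d - q * s) ->
  (forall s, b <= s < 1 -> exists2 h, H h & 0 < h s < b) ->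
  contains_kernel H.
Proof.
move=> HH dc dj c0 cd [u [Hu uid u2 orb]] Hw Hh q0 qr wid w2 hE orb'.
have [_ HM HV] := HH; have d0 : 0 < d by case: dj => j ->; rewrite invr_gt0 exprn_gt0.
have he : h e = c + d by have := hE 0; rewrite mulr0 !subr0; apply => //; exact: ltW.
have hV s : 0 <= s <= d -> (h^-1)%g (c + d - s) = e - s / q.
  move=> /andP[s0 sd]; have qs : q * (s / q) = s by rewrite mulrC divfK // gt_eqF.
  by apply: thompson_invE; rewrite hE ?qs // divr_ge0 // ltW.
apply: (@window_kernel R H c d u (h * w * h^-1)%g) => //.
- by apply: (HM); [exact: HM|exact: HV].
- move=> s cs; rewrite !thompson_mulE wid ?thompsonKV //.
  by rewrite -(thompson_invE he) thompson_le.
- move=> s /andP[s0 sd]; rewrite !thompson_mulE hV; last by rewrite s0; lra.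
  have qs : q * (s / q) = s by rewrite mulrC divfK // gt_eqF.
  have sq0 : 0 <= s / q by rewrite divr_ge0 // ltW.
  rewrite w2; last first.
    by rewrite sq0 ler_pdivrMr // mulrC; apply: le_trans qr.
  have q2s : q * (2 * (s / q)) = 2 * s by rewrite mulrCA qs.
  by rewrite hE; [rewrite q2s|rewrite mulr_ge0|rewrite q2s; lra].
- move=> s /andP[s0 s1]; case: (ltP s b) => sb; first by apply: orb; rewrite s0.
  have [|g Hg gs] := orb' s; first by rewrite sb.
  have [k Hk ks] := orb _ gs.
  by exists (k * g)%g => //; exact: HM.
Qed.

(** A nontrivial slope of [x] at 1 yields the right half-window from germs. The left one comes from
    germs too, unless [x] has slope 1 at 0; then the exponent at 1, the fixed point of [t], is a
    unit, and [x] or its inverse has slope 2 there. *)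
Lemma antidiagonal_kernel_right x : (thompson_pi x).2 != 0 ->
  absz (((thompson_pi x).1 : int) + (thompson_pi x).2)%R = 1%N ->
  \forall k \near \oo, forall t H, end_shape 1 (2 ^- k) 1 t ->
    end_shape 1 (2 ^- k) 1 (flip t^-1)%g -> is_subgroup H -> H x -> H t ->
    contains_kernel H.
Proof.
move=> x2 x12.
have tr : end_transverse 1 x 1.
  have [x1|x1] := eqVneq ((thompson_pi x).1 : int) 0; last by left; split.
  right; split=> //; rewrite x1 add0r in x12.
  have [g [gx gE]] : exists g, (g = x \/ g = (x^-1)%g) /\ (thompson_pi g).2 = 1.
    have [g [gx]] := thompson_pi1_abs (flip x); rewrite flip_pi1 x12 => gE.
    exists (flip g); split; last by rewrite flip_pi2.
    by case: gx => ->; [left|right]; rewrite ?flipV flipK.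
  exists g => //; right; have [e /andP[e0 _] ge] := thompson_pi2P g.
  by exists e => // s /ge ->; rewrite gE expr1z.
have [g [gx gE]] := thompson_pi1_abs (flip x).
have [e /andP[e0 _] ge] := thompson_pi1P g; rewrite gE in ge.
near=> k => t H tS tS' HH Hx Ht.
have [z zE] : exists z : R, z = 2 ^- k by exists (2 ^- k).
rewrite -zE in tS tS'.
have z0 : 0 < z by rewrite zE invr_gt0 exprn_gt0.
have ze : 3 * z <= e by rewrite zE; near: k; exact: small_grid_near.
have z1 : 5 * z <= 1 by rewrite zE; near: k; exact: small_grid_near.
have [c [d [dj [dc cz] cd [[i iE] dz] cP]]] : end_window_at 1 x 1 z.
  by rewrite zE; near: k; apply: end_window_at_near => //; [exact: dyadic1|lra].
have [_ HM HV] := HH.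
have HH' := is_subgroup_flip HH.
have Hg : [set f | H (flip f)] g.
  by case: gx => ->; rewrite /= ?flipV flipK //; exact: HV.
have Ht' : [set f | H (flip f)] (flip t^-1)%g by rewrite /= flipK; exact: HV.
have p0 : (0 < `|(thompson_pi (flip x)).1 : int|)%N by rewrite absz_gt0 flip_pi1.
have [//|u [Hu uid u2 _]] := end_window_linear HH' Ht' Hg z0 z1 tS' p0 _ ze ge.
have d0 : 0 < d by case: dj => j ->; rewrite invr_gt0 exprn_gt0.
have [m mE] : exists m : nat, c + d + m%:R * z = 1 - 2 * z.
  have oneE : 1 = (2 ^ k)%N%:R * z by rewrite zE natrX divff // expf_neq0.
  have ik : (i + 2 <= 2 ^ k)%N.
    rewrite -(ler_nat R) -(ler_pM2r z0) -oneE natrD mulrDl -iE.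
    by move: cd; clear; move=> ?; lra.
  exists (2 ^ k - (i + 2))%N; rewrite natrB // natrD iE mulrBl -oneE.
  by clear; ring.
apply: (@window_match H 1 c d (1 - 2 * z) (z / 2) 1 (flip u) ((t ^+ m)^-1)%g) => //.
- by move: cz z0; clear; move=> *; lra.
- by move: cd z0; clear; move=> *; lra.
- exact: (cP H t HH Hx Ht tS).
- by apply: HV; exact: is_subgroupX.
- by rewrite mul1r ler_pM2r.
- by move=> s s1; rewrite flipE uid ?subKr //; move: s1; clear; move=> *; lra.
- move=> s s1; rewrite flipE; have -> : 1 - (1 - 2 * z - s) = 2 * z + s by ring.
  by rewrite u2 //; ring.
- move=> s s0; rewrite mul1r => sd; apply: thompson_invE.
  rewrite (end_shape_shift z0 tS); [|by move: cz sd; clear; move=> *; lra|].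
    by move: mE; clear; move=> mE; lra.
  by move: mE s0 z0; clear; move=> *; lra.
- by move=> s /andP[s1 s1']; move: s1'; rewrite ltNge s1.
Unshelve. all: end_near. Qed.

(** The two exponents cannot both vanish, and the reflection exchanges them. *)
Lemma antidiagonal_kernel x : absz (((thompson_pi x).1 : int) + (thompson_pi x).2)%R = 1%N ->
  \forall k \near \oo, forall t H, end_shape 1 (2 ^- k) 1 t ->
    end_shape 1 (2 ^- k) 1 (flip t^-1)%g -> is_subgroup H -> H x -> H t ->
    contains_kernel H.
Proof.
move=> x12; have [x2|x2] := eqVneq ((thompson_pi x).2 : int) 0; last first.
  exact: antidiagonal_kernel_right.
have [||k kP] := @antidiagonal_kernel_right (flip x).
- by rewrite flip_pi2; move: x12; rewrite x2 addr0 => x12; apply: contra_eqN x12 => /eqP ->.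
- by rewrite flip_pi1 flip_pi2 addrC.
move=> kP'; exists k => // n kn t H tS tS' HH Hx Ht f f1.
have [_ _ HV] := HH.
have := kP' n kn (flip t^-1)%g [set f | H (flip f)] tS'.
rewrite flipV flipK invgK => /(_ tS (is_subgroup_flip HH)) K.
rewrite -[f]flipK; apply: K => //=; rewrite ?flipV ?flipK //.
- exact: HV.
- by rewrite flip_pi f1.
Qed.

End Matching.

(** * Crossing a point moved by the first generator *)

Section UnfixedPoint.
Variable R : realType.
Implicit Types (f g h t u v w x y : thompsonF R) (c d e q r s z : R).
Implicit Types (H : set (thompsonF R)).

Lemma thompson_contract x b : x b != b ->
  exists2 g, g = x \/ g = (x^-1)%g & g b < b.
Proof.
rewrite neq_lt => /orP[xb|xb]; first by exists x => //; left.
by exists (x^-1)%g; [right|rewrite -(thompson_lt x) thompsonKV].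
Qed.

Lemma thompsonX_fix f s n : f s = s -> (f ^+ n)%g s = s.
Proof. by move=> fs; elim: n => // n IH; rewrite expgS thompson_mulE IH. Qed.

Lemma thompsonX_eq_right f g b n s : f b = b -> (forall s, b <= s <= 1 -> f s = g s) ->
  b <= s <= 1 -> (f ^+ n)%g s = (g ^+ n)%g s.
Proof.
move=> fb fg /andP[bs s1]; elim: n => // n IH.
rewrite !expgS !thompson_mulE -IH fg // -{1}(thompsonX_fix n fb) thompson_le bs /=.
by rewrite -(thompson1 (f ^+ n)%g) thompson_le.
Qed.

Lemma end_shape_transport (a : nat) H z b t p c d (i j : nat) : is_subgroup H -> H t ->
  0 < z -> end_shape a z b t -> p = i%:R * z -> c + d = j%:R * z -> 0 <= d <= z ->
  3 * z <= p -> p <= b - z -> 2 * z <= c -> c + d <= b - z ->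
  exists2 h, H h & forall s, 0 <= s <= d -> h (p - s) = c + d - s.
Proof.
move=> HH Ht z0 tS pE cdE dI pz pb cz cdb; have [_ _ HV] := HH.
have HtX n := is_subgroupX n HH Ht; have shift := end_shape_shift z0 tS.
case: (leqP j i) => ij.
  exists ((t ^+ (i - j))^-1)%g; first exact: HV.
  have mE : (i - j)%:R * z = p - (c + d) by rewrite natrB // mulrBl pE cdE.
  move=> s sI; apply: thompson_invE; rewrite shift ?mE; try lra.
exists (t ^+ (j - i))%g => // s sI.
have mE : (j - i)%:R * z = c + d - p by rewrite natrB ?(ltnW ij) // mulrBl pE cdE.
by rewrite shift ?mE; lra.
Qed.

(** Powers of [tR] push the end [1 - c'] of the right half-window so close to [p] that [g] throws it
    below [p]. Its image [P] depends only on the data right of [p] and on [x], so the step on the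
    left can still be taken small enough for [P] to be a grid point and for [h0] to be linear on the
    piece transported. [tL] and [tR] are separate because the second generator may have to be
    inverted for one side only. *)
Lemma unfixed_kernel (a b : nat) x p z' t' : dyadic p -> 0 < p < 1 -> x p != p ->
  end_transverse a x p -> 0 < z' -> 5 * z' <= 1 - p ->
  end_window_at b (flip x) (1 - p) z' -> end_shape b z' (1 - p) t' ->
  \forall k \near \oo, forall (tL tR : thompsonF R) H, end_shape a (2 ^- k) p tL ->
    (forall s, 0 <= s <= 1 - p -> flip tR s = t' s) ->
    is_subgroup H -> H x -> H tL -> H tR -> contains_kernel H.
Proof.
move=> dp p01 xp tr z'0 z'5 [c' [d' [dj' [dc' c'z] cd' _ RP]]] tS'.
have [g gx gp] := thompson_contract xp.
have d'0 : 0 < d' by case: dj' => j ->; rewrite invr_gt0 exprn_gt0.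
have t'p := end_shape_fix (ltW z'0) tS'.
have [n nP] : exists n, p < (flip t' ^+ n)%g (1 - c') < (g^-1)%g ((g p + p) / 2).
  (* For [b = 0] the map [t'] is trivial on [[0, z']], and its orbits climb only above [z']. *)
  pose al := if b is 0%N then z' else 0.
  have t'al : t' al = al.
    rewrite /al; case: (b) tS' => [[[tid _] _ _]|? _]; last exact: thompson0.
    by apply: tid; rewrite lexx ltW.
  have al2 : 0 <= al <= z' by rewrite /al; case: (b); rewrite ?lexx ?(ltW z'0).
  have t'gt s : al < s < 1 - p -> s < t' s.
    by move=> /andP[]; exact: (end_shape_gt z'0 tS').
  have eta : p < (g^-1)%g ((g p + p) / 2).
    by rewrite -(thompson_lt g) thompsonKV; lra.
  have [||n nP] := @thompson_iter_reach R t' al (1 - p)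
    (1 - (g^-1)%g ((g p + p) / 2)) c' t'al t'p t'gt; [lra|lra|].
  exists n; have -> : (flip t' ^+ n)%g (1 - c') = 1 - (t' ^+ n)%g c'.
    have -> : (flip t' ^+ n)%g = flip (t' ^+ n)%g.
      by elim: (n) => [|m IH]; rewrite ?expg0 ?flip1 // !expgS flipM IH.
    by rewrite flipE subKr.
  have : (t' ^+ n)%g c' < 1 - p.
    by rewrite -[ltRHS](thompsonX_fix n t'p) thompson_lt; lra.
  by move: nP; clear; move=> *; lra.
pose B := 1 - c'; pose h0 := (g * flip t' ^+ n)%g; pose P := h0 B.
have PI : 0 < P < p.
  rewrite /P thompson_gt0 /B; apply/andP; split; first by lra.
  rewrite /h0 thompson_mulE; apply: (@lt_trans _ _ ((g p + p) / 2)); last by lra.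
  by rewrite -[ltRHS](thompsonKV g) thompson_lt; case/andP: nP.
have [|k0 [e0 [e00 _ h0E]]] := @left_germ R h0 B; first by rewrite /B; lra.
have [q qE] : exists q : R, q = 2 ^ k0 by exists (2 ^ k0).
have q0 : 0 < q by rewrite qE exprz2_gt0.
rewrite -qE -/P in h0E.
have [r0 [r00 re rB]] : exists r, [/\ 0 < r, r <= e0 & r <= B - p].
  exists (Num.min e0 (B - p)); split; rewrite ?lt_min ?ge_min ?lexx ?orbT // e00 /=.
  by rewrite /B; lra.
have dP : dyadic P.
  apply/thompson_dyadic; first by rewrite /B; lra.
  by apply: dyadicB => //; exact: dyadic1.
near=> k => tL tR H tS tE HH Hx HL HR.
have [z zE] : exists z : R, z = 2 ^- k by exists (2 ^- k).
rewrite -zE in tS.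
have z0 : 0 < z by rewrite zE invr_gt0 exprn_gt0.
have [i iE] : exists i : nat, P = i%:R * z.
  by rewrite zE; near: k; apply: dyadic_grid_near => //; case/andP: (PI).
have n1 : 3 * z <= P by rewrite zE; near: k; apply: small_grid_near; case/andP: (PI).
have n2 : 1 * z <= p - P by rewrite zE; near: k; apply: small_grid_near; rewrite subr_gt0; case/andP: (PI).
have n3 : 1 * z <= q * r0 by rewrite zE; near: k; apply: small_grid_near; rewrite mulr_gt0.
have n4 : 1 * z <= q * d' by rewrite zE; near: k; apply: small_grid_near; rewrite mulr_gt0.
have [c [d [dj [dc cz] cd [[j jE] dz] LP]]] : end_window_at a x p z.
  by rewrite zE; near: k; apply: end_window_at_near => //; lra.
have d0 : 0 < d by case: dj => l ->; rewrite invr_gt0 exprn_gt0.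
have [_ HM HV] := HH; have HH' := is_subgroup_flip HH.
have Hg : H g by case: gx => ->; [|exact: HV].
have tS'R : end_shape b z' (1 - p) (flip tR) by exact: end_shape_ext tE tS'.
have [||u [Hu uid u2 orb]] := RP [set f | H (flip f)] (flip tR) HH' _ _ tS'R.
- by rewrite /= flipK.
- by rewrite /= flipK.
have tRp : tR p = p.
  have := tE (1 - p); rewrite flipE t'p subKr => tRp.
  have : 1 - tR p = 1 - p by apply: tRp; move: (p01); clear; move=> *; lra.
  by clear; move=> *; lra.
have tRE s : p <= s <= 1 -> tR s = flip t' s.
  move=> sI; have := tE (1 - s); rewrite !flipE subKr => tRs.
  have : 1 - tR s = t' (1 - s) by apply: tRs; move: sI; clear; move=> *; lra.
  by clear; move=> *; lra.
have tRX s : p <= s <= 1 -> (tR ^+ n)%g s = (flip t' ^+ n)%g s.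
  exact: thompsonX_eq_right.
have [|||h1 Hh1 h1E] := end_shape_transport HH HL z0 tS iE jE _ n1 _ cz _.
- by rewrite dz ltW.
- by move: n2; clear; move=> *; lra.
- by move: cd z0; clear; move=> *; lra.
have BI : p <= B <= 1 by rewrite /B; move: (p01) (c'z) (cd') (d'0) (z'0); clear; move=> *; lra.
have HB : H (g * tR ^+ n)%g by apply: (HM) => //; exact: is_subgroupX.
have hB : (g * tR ^+ n)%g B = P by rewrite /P /h0 !thompson_mulE tRX.
apply: (@window_match R H p c d B (d / (2 * q)) q (flip u) (h1 * (g * tR ^+ n))%g) => //.
- by move: cz z0; clear; move=> *; lra.
- by move: cd z0 (p01); clear; move=> *; lra.
- exact: (LP H tL HH Hx HL tS).
- exact: HM.
- by rewrite le_eqVlt; apply/orP; left; apply/eqP; move: (q0); clear=> q0; field; exact: lt0r_neq0.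
- move=> s Bs; rewrite flipE uid ?subKr //; move: Bs; rewrite /B; clear; move=> *; lra.
- move=> s /andP[s0 sd]; rewrite flipE /B.
  have -> : 1 - (1 - c' - s) = c' + s by ring.
  rewrite u2 ?s0 /=; first by ring.
  have sq : s * (2 * q) <= d by rewrite -ler_pdivlMr // mulr_gt0.
  have dq : d <= q * d' by apply: le_trans dz _; rewrite -[z]mul1r.
  by rewrite -(ler_pM2l q0); move: sq dq; clear; move=> *; lra.
- move=> s s0 sd; have sr : s <= r0.
    by rewrite -(ler_pM2l q0); apply: le_trans n3; rewrite mul1r; apply: le_trans dz.
  rewrite thompson_mulE.
  have -> : (g * tR ^+ n)%g (B - s) = P - q * s.
    rewrite thompson_mulE tRX; last by move: BI (rB) sr s0; clear; move=> *; lra.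
    by rewrite -thompson_mulE -/h0 h0E // s0 (le_trans sr re).
  by apply: h1E; rewrite sd mulr_ge0 // ltW.
- have gpos s : s < 1 -> p <= s -> g s < p -> exists2 h, H h & 0 < h s < p.
    move=> s1 ps gs; exists g => //; rewrite thompson_gt0 gs andbT.
    by apply: lt_le_trans ps; case/andP: (p01).
  move=> s /andP[ps s1]; have [sE|sn] := eqVneq s p; first by subst s; exact: gpos.
  have [|h Hh hI] := orb (1 - s).
    by rewrite subr_gt0 s1 ltrD2l ltrN2 lt_neqAle eq_sym sn.
  exists ((g * tR ^+ n) * flip h)%g; first exact: HM.
  have s0 : 0 < s by apply: lt_le_trans ps; case/andP: (p01).
  rewrite thompson_mulE !thompson_gt0 s0 /=.
  apply: (@lt_trans _ _ P); last by case/andP: (PI).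
  by rewrite -hB thompson_lt flipE /B; move: hI; clear; move=> *; lra.
Unshelve. all: end_near. Qed.

End UnfixedPoint.

(** Finiteness of [S] enters here. *)
Lemma finite_near_infty (T : choiceType) (S : set T) (P : T -> nat -> Prop) : finite_set S ->
  (forall x, S x -> \forall k \near \oo, P x k) ->
  \forall k \near \oo, forall x, S x -> P x k.
Proof.
move=> /finite_seqP[s ->] {S}; elim: s => [|x s IH] sP.
  by near=> k => x.
have [|K _ KP] := IH; first by move=> y ys; apply: sP; rewrite /= inE (orbC (y == x)) ys.
have [|L _ LP] := sP x; first exact: mem_head.
exists (maxn K L) => // k /=; rewrite geq_max => /andP[Kk Lk] y /=.
by rewrite inE => /orP[/eqP ->|]; [exact: LP|exact: KP].
Unshelve. all: end_near. Qed.

(** * Generating pairs of Z^2 *)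

Section Zsquare.
Implicit Types p v : Zgrp * Zgrp.

(** Writing the two unit vectors as integer combinations of [p] and [v] gives an integer matrix
    inverse to theirs, and the two determinants multiply to 1. *)
Lemma cogenerator_det p v : cogenerator p v ->
  absz ((v.1 : int) * p.2 - (v.2 : int) * p.1)%R = 1%N.
Proof.
move=> pv; pose K := [set u : Zgrp * Zgrp | exists i j : int,
  (u.1 : int) = i * p.1 + j * v.1 /\ (u.2 : int) = i * p.2 + j * v.2].
have KK : is_subgroup K.
  split=> [|x y [i [j [x1 x2]]] [k [l [y1 y2]]]|x [i [j [x1 x2]]]].
  - by exists 0, 0; split; rewrite !mul0r addr0.
  - exists (i + k), (j + l); split; rewrite !mulrDl.
      by rewrite -[LHS]/((x.1 : int) + (y.1 : int)) x1 y1; ring.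
    by rewrite -[LHS]/((x.2 : int) + (y.2 : int)) x2 y2; ring.
  - exists (- i), (- j); split.
      by rewrite -[LHS]/(- (x.1 : int)) x1; ring.
    by rewrite -[LHS]/(- (x.2 : int)) x2; ring.
have Kall u : K u.
  have gu : generated [set p; v] u by rewrite pv.
  apply: (generated_sub KK _ gu) => _ [->|->].
    by exists 1, 0; split; rewrite mul1r mul0r addr0.
  by exists 0, 1; split; rewrite mul1r mul0r add0r.
have [i [j [/= e1 e2]]] := Kall ((1 : int), (0 : int)).
have [k [l [/= e3 e4]]] := Kall ((0 : int), (1 : int)).
have : (k * j - i * l) * ((v.1 : int) * p.2 - (v.2 : int) * p.1) = 1.
  transitivity ((i * (p.1 : int) + j * v.1) * (k * p.2 + l * v.2) -
                (i * p.2 + j * v.2) * (k * (p.1 : int) + l * v.1)); first by ring.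
  by rewrite -e1 -e2 -e3 -e4; ring.
by move=> /(congr1 absz); rewrite abszM => /eqP; rewrite muln_eq1 => /andP[_ /eqP].
Qed.

End Zsquare.

(** * Co-generators *)

Section Main.
Variable R : realType.
Implicit Types (f g h t u v w x y : thompsonF R) (c d e q r s z : R).
Implicit Types (S : set (thompsonF R)).

(** A subgroup that contains the kernel and maps onto the quotient is the whole group. *)
Lemma cogenerator_lift x y : cogenerator (thompson_pi x) (thompson_pi y) ->
  contains_kernel (generated [set x; y]) -> cogenerator x y.
Proof.
move=> xy ker; apply/seteqP; split=> // f _.
have HG := is_subgroup_generated [set x; y]; have [G1 GM GV] := HG.
pose K := [set p | exists2 h, generated [set x; y] h & thompson_pi h = p].
have KK : is_subgroup K.
  split=> [|p q [h Gh <-] [g Gg <-]|p [h Gh <-]].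
  - by exists 1%g => //; exact: thompson_pi_one.
  - by exists (h * g)%g; [exact: GM|exact: thompson_piM].
  - by exists (h^-1)%g; [exact: GV|exact: thompson_piV].
have [h Gh hf] : K (thompson_pi f).
  have pf : generated [set thompson_pi x; thompson_pi y] (thompson_pi f) by rewrite xy.
  apply: (generated_sub KK _ pf) => _ [->|->]; [exists x|exists y] => //.
    by refine (mem_generated _); left.
  by refine (mem_generated _); right.
have -> : f = (h * (h^-1 * f))%g by rewrite mulVKg.
by apply: GM => //; apply: ker; rewrite thompson_piM thompson_piV hf mulVg.
Qed.

Lemma cogenerator_proj x y : cogenerator x y ->
  cogenerator (thompson_pi x) (thompson_pi y).
Proof.
move=> xy; apply/seteqP; split=> // -[a b] _.
have [f <-] := thompson_pi_surj R a b.
have HG := is_subgroup_generated [set thompson_pi x; thompson_pi y].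
have [G1 GM GV] := HG.
pose K : set (thompsonF R) := [set f | generated [set thompson_pi x; thompson_pi y] (thompson_pi f)].
have HK : is_subgroup K.
  split=> [|g h Gg Gh|g Gg]; rewrite /K /=.
  - by rewrite thompson_pi_one.
  - by rewrite thompson_piM; exact: GM.
  - by rewrite thompson_piV; exact: GV.
have ff : generated [set x; y] f by rewrite xy.
suff : K f by [].
apply: (generated_sub HK _ ff) => _ [->|->]; rewrite /K /=.
  by refine (mem_generated _); left.
by refine (mem_generated _); right.
Qed.

(** With slope 2 at both ends, the graph of [y] is above the diagonal near 0 and below it near 1. *)
Lemma thompson_attracting_fixed y : thompson_pi y = (1 : int, 1 : int) ->
  exists2 s, 0 < s < 1 & y s = s.
Proof.
move=> yE; have [e e01 ey] := thompson_pi1P y; have [d d01 dy] := thompson_pi2P y.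
rewrite yE expr1z in ey dy.
have [yo yh yc _] := thompson_homeo y.
have ye : y (e / 3) = 2 * (e / 3) by apply: ey; lra.
have yd : y (1 - d / 3) = 1 - 2 * (d / 3) by apply: dy; lra.
have fc : {within `[e / 3, 1 - d / 3], continuous (fun s => y s - s)}.
  apply: continuous_subspaceT => s; apply: cvgB; [exact: yc|exact: cvg_id].
have [||s sI ys] := IVT _ fc (v := 0); first lra.
  rewrite ye yd ge_min le_max; apply/andP; split; apply/orP; [right|left]; lra.
exists s; last by move: ys; lra.
by move: sI; rewrite in_itv /=; lra.
Qed.

Lemma no_common_fixed_point x y s : cogenerator x y -> 0 < s < 1 ->
  x s = s -> y s <> s.
Proof.
move=> xy s01 xs ys.
(* A translation moves every point of (0, 1), so the stabilizer of [s] is proper; any step [z] with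
   [5 * z <= 1] would do. *)
have [|||t [tS _ _]] := @translation_exists R (2 ^- 3); [exact: dyadicVX| | |].
- by rewrite invr_gt0 exprn_gt0.
- by rewrite ler_pdivrMr ?exprn_gt0 // mul1r -natrX ler_nat.
have HF : is_subgroup [set f : thompsonF R | f s = s].
  split=> [|f g /= fs gs|f /= fs] //=; first by rewrite thompson_mulE gs.
  exact: thompson_invE.
have tG : generated [set x; y] t by rewrite xy.
have ts : t s = s by apply: (generated_sub HF _ tG) => _ [->|->].
have z0 : 0 < (2 : R) ^- 3 by rewrite invr_gt0 exprn_gt0.
have /andP[s0 s1] := s01.
by have := end_shape_gt z0 tS s0 s1; rewrite ts ltxx.
Qed.

Lemma antidiagonal_cogenerator S : finite_set S ->
  common_cogenerator (@thompson_pi R @` S) ((1 : int), (-1 : int)) ->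
  exists y, common_cogenerator S y.
Proof.
move=> finS Sv.
have : \forall k \near \oo, forall x, S x -> forall t H, end_shape 1 (2 ^- k) 1 t ->
    end_shape 1 (2 ^- k) 1 (flip t^-1)%g -> is_subgroup H -> H x -> H t ->
    contains_kernel H.
  apply: finite_near_infty => // x Sx; apply: antidiagonal_kernel.
  have /cogenerator_det /= : cogenerator (thompson_pi x) ((1 : int), (-1 : int)).
    by apply: Sv; exists x.
  by rewrite mul1r mulN1r opprK addrC.
move=> near1.
near \oo => k.
have near2 : forall x, S x -> forall t H, end_shape 1 (2 ^- k) 1 t ->
    end_shape 1 (2 ^- k) 1 (flip t^-1)%g -> is_subgroup H -> H x -> H t ->
    contains_kernel H by near: k.
have z1 : 5 * 2 ^- k <= 1 :> R by near: k; exact: small_grid_near.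
have z0 : 0 < (2 : R) ^- k by rewrite invr_gt0 exprn_gt0.
have [t [tS tS' tE]] := translation_exists (dyadicVX R k) z0 z1.
exists t => x Sx; apply: cogenerator_lift; first by rewrite tE; apply: Sv; exists x.
apply: (near2 x Sx t) => //; first exact: is_subgroup_generated.
  by refine (mem_generated _); left.
by refine (mem_generated _); right.
Unshelve. all: end_near. Qed.

(** The dyadic points approach [s] from below. If [x] lowers [s], no point between [x s] and [s] is
    fixed; if it raises [s], none between the preimage of [s] and [s]. *)
Lemma unfixed_dyadic_near x s : 0 < s < 1 -> x s <> s ->
  \forall k \near \oo, x ((Num.floor (s * 2 ^+ k))%:~R / 2 ^+ k) <>
    (Num.floor (s * 2 ^+ k))%:~R / 2 ^+ k.
Proof.
move=> s01 xs.
have [e e0 xe] : exists2 e, 0 < e & forall r, s - e < r <= s -> x r <> r.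
  have /eqP := xs; rewrite neq_lt => /orP[ltx|ltx].
    exists (s - x s) => [|r rI xr]; first by rewrite subr_gt0.
    have : x r <= x s by rewrite thompson_le; lra.
    by rewrite xr; lra.
  exists (s - (x^-1)%g s) => [|r rI xr].
    by rewrite subr_gt0 -(thompson_lt x) thompsonKV.
  have : x ((x^-1)%g s) < x r by rewrite thompson_lt; lra.
  by rewrite thompsonKV xr; lra.
near=> k; have k0 : 0 < (2 : R) ^+ k by rewrite exprn_gt0.
apply: xe; rewrite ler_pdivrMr // floor_le andbT ltr_pdivlMr //.
have /andP[_] := floor_itv (s * 2 ^+ k).
have ek : 2 * 2 ^- k <= e by near: k; exact: small_grid_near.
move: ek; rewrite ler_pdivrMr // mulrBl intrD; lra.
Unshelve. all: end_near. Qed.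

Lemma unfixed_near0 x : (thompson_pi x).1 != 0 ->
  \forall k \near \oo, x (2 ^- k) <> 2 ^- k.
Proof.
have [e /andP[e0 _] xe] := thompson_pi1P x => x1.
near=> k; have z0 : 0 < (2 : R) ^- k by rewrite invr_gt0 exprn_gt0.
have ze : 1 * 2 ^- k <= e by near: k; exact: small_grid_near.
rewrite xe; last by rewrite (ltW z0) -[2 ^- k]mul1r.
rewrite -{2}[2 ^- k]mul1r => /mulIf; rewrite gt_eqF // => /(_ isT).
by rewrite -(expr0z 2) => /exprz_inj2 e1; rewrite e1 in x1.
Unshelve. all: end_near. Qed.

(** Otherwise all elements of [S] have slope different from 1 at 0, and a single [2 ^- k] is moved
    by all of them. *)
Lemma fixed_trivial_germ S : finite_set S ->
  (forall s, 0 < s < 1 -> exists2 x, S x & x s = s) ->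
  exists2 x, S x & (thompson_pi x).1 = 0.
Proof.
move=> finS fixed; apply: contrapT => nx.
have moved : \forall k \near \oo, forall x, S x -> x (2 ^- k) <> 2 ^- k.
  apply: finite_near_infty => // x Sx; apply: unfixed_near0.
  by apply/eqP => x0; apply: nx; exists x.
near \oo => k.
have z1 : 2 * 2 ^- k <= 1 :> R by near: k; exact: small_grid_near.
have z0 : 0 < (2 : R) ^- k by rewrite invr_gt0 exprn_gt0.
have [|x Sx] := fixed (2 ^- k); first lra.
by move: x Sx; near: k.
Unshelve. all: end_near. Qed.

Lemma unfixed_cogenerator S (a b : int) s : finite_set S ->
  common_cogenerator (@thompson_pi R @` S) (a, b) -> 0 < s < 1 ->
  (forall x, S x -> x s <> s) -> exists y, common_cogenerator S y.
Proof.
move=> finS Sv s01 xs.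
have [p [dp p01 xp]] : exists p : R, [/\ dyadic p, 0 < p < 1 & forall x, S x -> x p != p].
  have unfixed := finite_near_infty finS (fun x Sx => unfixed_dyadic_near s01 (xs x Sx)).
  near \oo => k.
  exists ((Num.floor (s * 2 ^+ k))%:~R / 2 ^+ k); split.
  - by exists (Num.floor (s * 2 ^+ k)), k.
  - have k0 : 0 < (2 : R) ^+ k by rewrite exprn_gt0.
    have ks : 2 * 2 ^- k <= s by near: k; apply: small_grid_near; case/andP: (s01).
    have /andP[f1 f2] := floor_itv (s * 2 ^+ k).
    rewrite ler_pdivrMr // in ks; rewrite intrD in f2.
    rewrite divr_gt0 //=; last by move: ks f2; clear; move=> *; lra.
    rewrite ltr_pdivrMr // mul1r; apply: le_lt_trans f1 _.
    by rewrite gtr_pMl //; case/andP: (s01).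
  - by move=> x Sx; apply/eqP; move: x Sx; near: k.
have det x : S x -> absz (a * (thompson_pi x).2 - b * (thompson_pi x).1)%R = 1%N.
  by move=> Sx; apply: (@cogenerator_det (thompson_pi x) (a, b)); apply: Sv; exists x.
(* Transversality is what the determinant gives: if the exponent of [y] at an end is 0, that of [x]
   is a unit, and they cannot both vanish. *)
have det0 (m n k l : int) : absz (m * n - k * l)%R = 1%N -> m = 0 -> absz l = 1%N /\ k != 0.
  move=> d1 m0; rewrite m0 mul0r sub0r abszN abszM in d1.
  move/eqP: d1; rewrite muln_eq1 => /andP[/eqP k1 /eqP l1]; split=> //.
  by apply: contra_eqN k1 => /eqP ->.
have trL x : S x -> end_transverse (absz a) x p.
  move=> Sx; have xdet := det x Sx.
  have [x1|x1] := eqVneq ((thompson_pi x).1 : int) 0; last first.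
    left; split=> // /eqP; rewrite absz_eq0 => /eqP a0.
    by have [] := det0 _ _ _ _ xdet a0.
  right; split=> //.
    apply/eqP => /eqP; rewrite absz_eq0 => /eqP a0.
    by have [] := det0 _ _ _ _ xdet a0; rewrite x1.
  by have [g gx gp] := thompson_contract (xp x Sx); exists g => //; left.
have trR x : S x -> end_transverse (absz b) (flip x) (1 - p).
  move=> Sx; have xdet : absz (b * (thompson_pi x).1 - a * (thompson_pi x).2)%R = 1%N.
    by rewrite -(det x Sx) -abszN opprB.
  rewrite /end_transverse flip_pi1.
  have [x1|x1] := eqVneq ((thompson_pi x).2 : int) 0; last first.
    left; split=> // /eqP; rewrite absz_eq0 => /eqP b0.
    by have [] := det0 _ _ _ _ xdet b0.
  right; split=> //.
    apply/eqP => /eqP; rewrite absz_eq0 => /eqP b0.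
    by have [] := det0 _ _ _ _ xdet b0; rewrite x1.
  have fp : flip x (1 - p) != 1 - p.
    by rewrite flipE subKr; apply: contra (xp x Sx) => /eqP/(addrI _)/oppr_inj ->.
  by have [g gx gp] := thompson_contract fp; exists g => //; left.
have [q01 dq] : 0 < 1 - p <= 1 /\ dyadic (1 - p).
  by split; [lra|apply: dyadicB => //; exact: dyadic1].
have [z' [dz' z'0 z'5 zR]] : exists z : R, [/\ dyadic z, 0 < z, 5 * z <= 1 - p &
    forall x, S x -> end_window_at (absz b) (flip x) (1 - p) z].
  have windows := finite_near_infty finS (fun x Sx => end_window_at_near dq q01 (trR x Sx)).
  near \oo => k; exists (2 ^- k); split.
  - exact: dyadicVX.
  - by rewrite invr_gt0 exprn_gt0.
  - by near: k; apply: small_grid_near; case/andP: (q01).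
  - by near: k.
have q1 : 1 - p <= 1 by case/andP: q01.
have [t' tS'] := end_shape_exists (absz b) dz' z'0 dq z'5 q1.
(* Only now, with [z'] and [t'] fixed, is the left step chosen: it must be small relative to
   them. *)
have [z [dz z0 z5 ker]] : exists z : R, [/\ dyadic z, 0 < z, 5 * z <= p &
    forall x, S x -> forall (tL tR : thompsonF R) H, end_shape (absz a) z p tL ->
    (forall s, 0 <= s <= 1 - p -> flip tR s = t' s) ->
    is_subgroup H -> H x -> H tL -> H tR -> contains_kernel H].
  have kernels := finite_near_infty finS (fun x Sx =>
    unfixed_kernel dp p01 (xp x Sx) (trL x Sx) z'0 z'5 (zR x Sx) tS').
  near \oo => k; exists (2 ^- k); split.
  - exact: dyadicVX.
  - by rewrite invr_gt0 exprn_gt0.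
  - by near: k; apply: small_grid_near; case/andP: (p01).
  - by near: k.
have [p0 p1] : 0 < p /\ p < 1 by case/andP: p01.
have [t tS] := end_shape_exists (absz a) dz z0 dp z5 (ltW p1).
have tp := end_shape_fix (ltW z0) tS; have t'q := end_shape_fix (ltW z'0) tS'.
have t'p : flip t' p = p by rewrite flipE t'q subKr.
(* The shapes realise the absolute values of the exponents; inverting the two sides of [p]
   independently restores the signs of [a] and [b]. *)
pose yL := if 0 <= a then t else (t^-1)%g.
pose yR := if 0 <= b then flip t' else ((flip t')^-1)%g.
have yLp : yL p = p by rewrite /yL; case: ifP => // _; exact: thompson_invE.
have yRp : yR p = p by rewrite /yR; case: ifP => // _; exact: thompson_invE.
have p01' : 0 <= p <= 1 by rewrite !ltW.
have [y yE] := thompson_glue dp p01' yLp yRp.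
have yEL r : r <= p -> y r = yL r by move=> rp; rewrite yE rp.
have yER r : p <= r -> y r = yR r.
  rewrite le_eqVlt => /orP[/eqP <-|pr]; first by rewrite yE lexx yLp yRp.
  by rewrite yE leNgt pr.
have piy : thompson_pi y = (a, b).
  rewrite [LHS]surjective_pairing; congr pair.
    rewrite (@thompson_pi1_ext _ y yL p p0); last by move=> r /andP[_]; exact: yEL.
    have ta := end_shape_pi z0 tS; rewrite /yL; case: ifP => a0.
      by rewrite ta gez0_abs.
    rewrite thompson_piV -[LHS]/(- ((thompson_pi t).1 : int)) ta ltz0_abs ?opprK //.
    by rewrite ltNge a0.
  rewrite -flip_pi1 (@thompson_pi1_ext _ (flip y) (flip yR) (1 - p)); last 2 first.
  - by rewrite subr_gt0.
  - by move=> r rI; rewrite !flipE yER //; lra.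
  rewrite flip_pi1; have tb := end_shape_pi z'0 tS'; rewrite /yR; case: ifP => b0.
    by rewrite flip_pi2 tb gez0_abs.
  rewrite thompson_piV -[LHS]/(- ((thompson_pi (flip t')).2 : int)) flip_pi2 tb.
  by rewrite ltz0_abs ?opprK // ltNge b0.
pose tL := if 0 <= a then y else (y^-1)%g.
pose tR := if 0 <= b then y else (y^-1)%g.
have tLE r : r <= p -> tL r = t r.
  move=> rp; have := yEL; rewrite /tL /yL; case: ifP => _ yEL'; first exact: yEL'.
  apply: thompson_invE; rewrite yEL' ?thompsonK //.
  by rewrite -tp thompson_le.
have tRE r : p <= r -> tR r = flip t' r.
  move=> rp; have := yER; rewrite /tR /yR; case: ifP => _ yER'; first exact: yER'.
  apply: thompson_invE; rewrite yER' ?thompsonK //.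
  by rewrite -t'p thompson_le.
exists y => x Sx; apply: cogenerator_lift; first by rewrite piy; apply: Sv; exists x.
have HG := is_subgroup_generated [set x; y]; have [_ _ GV] := HG.
have Gy : generated [set x; y] y by refine (mem_generated _); right.
apply: (ker x Sx tL tR) => //.
- by apply: (end_shape_ext z0 z5 _ tS) => r /andP[_]; exact: tLE.
- move=> r rI; rewrite flipE tRE; last lra.
  by rewrite flipE !subKr.
- by refine (mem_generated _); left.
- by rewrite /tL; case: ifP => _ //; exact: GV.
- by rewrite /tR; case: ifP => _ //; exact: GV.
Unshelve. all: end_near. Qed.

End Main.

Unset Implicit Arguments.

Theorem corollary4 (R : realType) (S : set (thompsonF R))
    (finS : finite_set S)
    (cogenS : exists v : Zgrp * Zgrp, common_cogenerator (@thompson_pi R @` S) v) :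
  ~ (exists y : thompsonF R, common_cogenerator S y) <->
  ((forall v : Zgrp * Zgrp,
      common_cogenerator (@thompson_pi R @` S) v <->
      v = ((1 : int), (1 : int)) \/ v = ((-1 : int), (-1 : int))) /\
   (forall beta : R, 0 < beta < 1 -> exists2 f, S f & f beta = beta)).
Proof.
split=> [noy|[diag fixed] [y Sy]]; last first.
  have : thompson_pi y = ((1 : int), (1 : int)) \/ thompson_pi y = ((-1 : int), (-1 : int)).
    by apply/diag => _ [x Sx <-]; apply: cogenerator_proj; exact: Sy.
  move=> yE; have [s s01 ys] : exists2 s, 0 < s < 1 & y s = s.
    case: yE => yE; first exact: thompson_attracting_fixed.
    have [|s s01 ys] := @thompson_attracting_fixed R (y^-1)%g; first by rewrite thompson_piV yE.
    by exists s => //; rewrite -{1}ys thompsonKV.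
  have [x Sx xs] := fixed s s01.
  exact: no_common_fixed_point (Sy x Sx) s01 xs ys.
have [[a b] Sv] := cogenS.
have fixed (beta : R) : 0 < beta < 1 -> exists2 f, S f & f beta = beta.
  move=> b01; apply: contrapT => nofix; apply: noy.
  apply: (unfixed_cogenerator finS Sv b01) => x Sx xb.
  by apply: nofix; exists x.
(* By the determinant, an element with slope 1 at 0 makes the first coordinate of every common
   co-generator a unit; one with slope 1 at 1 does the same for the second. *)
have [x Sx x1] := fixed_trivial_germ finS fixed.
have [_ [y Sy <-] y2] : exists2 x, (@flip R @` S) x & (thompson_pi x).1 = 0.
  apply: fixed_trivial_germ => [|s s01]; first exact: finite_image.
  have [|y Sy ys] := fixed (1 - s); first lra.
  by exists (flip y); [exists y|rewrite flipE ys subKr].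
rewrite flip_pi1 in y2.
have opp (v : Zgrp * Zgrp) : common_cogenerator (@thompson_pi R @` S) v ->
    common_cogenerator (@thompson_pi R @` S) (- (v.1 : int), - (v.2 : int)).
  by move=> vS p Sp; exact: cogeneratorV (vS p Sp).
have diag (v : Zgrp * Zgrp) : common_cogenerator (@thompson_pi R @` S) v ->
    v = ((1 : int), (1 : int)) \/ v = ((-1 : int), (-1 : int)).
  case: v => [c d] vS.
  have : cogenerator (thompson_pi x) (c, d) by apply: vS; exists x.
  move=> /cogenerator_det; rewrite x1 mulr0 subr0 abszM => /eqP.
  rewrite muln_eq1 => /andP[/eqP c1 _].
  have : cogenerator (thompson_pi y) (c, d) by apply: vS; exists y.
  move=> /cogenerator_det; rewrite y2 mulr0 sub0r abszN abszM => /eqP.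
  rewrite muln_eq1 => /andP[/eqP d1 _].
  have pm (n : int) : absz n = 1%N -> n = 1 \/ n = -1 by lia.
  (* Mixed signs give [(1, -1)], up to passing to the opposite vector, and this would lift to a
     common co-generator in F. *)
  case: (pm c c1) vS => ->; case: (pm d d1) => -> vS; [by left| | |by right].
    by case: noy; exact: antidiagonal_cogenerator vS.
  by case: noy; apply: antidiagonal_cogenerator => //; exact: opp vS.
split=> // v; split; first exact: diag.
by case: (diag _ Sv) => abE; rewrite abE in Sv; case=> ->; [|exact: opp Sv|exact: opp Sv|].
Qed.
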